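(* Let $N\ge 1$, let $p$ be a prime, $r\ge 1$ an integer, and let $f\in\mathcal{M}_{k,h}(N)$ have product expansion $f(\tau)=q^{h}\prod_{n=1}^{\infty}(1-q^{n})^{c(n)}$. Then: (1) $f|\mathcal{T}(p^{r})\in\mathcal{M}_{k\sigma(p^{r}),\,h\sigma(p^{r})}(N)$ if $p\nmid N$, and $f|\mathcal{T}(p^{r})\in\mathcal{M}_{kp^{r},\,h}(N)$ if $p\mid N$. (2) We have $$f|\mathcal{T}(p^{r})=\begin{cases} q^{h\sigma(p^{r})}\prod_{n=1}^{\infty}(1-q^{n})^{c_{p^{r}}(n)} & \text{if } p\nmid N,\\ q^{h}\prod_{n=1}^{\infty}(1-q^{n})^{c_{p^{r}}(n)} & \text{if } p\mid N,\end{cases}$$ where, if $p\nmid N$, $$c_{p^{r}}(n)=\sum_{i=0}^{r}p^{i}\,\tilde c\Big(p^{i},\frac{n}{p^{r-i}}\Big)+\sum_{j=0}^{r-1}\sum_{i=0}^{j}\chi_{p}\Big(\frac{n}{p^{r-j-1}}\Big)p^{i}\,\tilde c\Big(p^{i},\frac{n}{p^{r-j-1}}\Big),$$ and, if $p\mid N$, $$c_{p^{r}}(n)=p^{r}\tilde c(p^{r},n)+\sum_{i=0}^{r-1}\chi_{p}(n)p^{i}\tilde c(p^{i},n).$$ Here, for integers $X,Y,Z$ with $Z\neq 0$, $\tilde c(X,Y/Z):=c(XY/Z)$ if $Z\mid Y$ and $:=0$ if $Z\nmid Y$, and $\chi_p$ is the trivial Dirichlet character modulo $p$.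
   Context: Let $\mathbb{H}$ be the upper half-plane and $q=e^{2\pi i\tau}$. For $N\ge1$, $\mathcal{M}(N)$ denotes the multiplicative group of functions $f$ on $\mathbb{H}$ that are meromorphic modular forms of some integer weight $k$ for $\Gamma_0(N)$ with some unitary multiplier system $\chi:\Gamma_0(N)\to S^1$ (i.e. $f(\gamma\tau)=\chi(\gamma)(c\tau+d)^k f(\tau)$ for all $\gamma=\begin{psmallmatrix}a&b\\c&d\end{psmallmatrix}\in\Gamma_0(N)$, and $f$ is meromorphic at the cusps), whose Fourier expansion at $i\infty$ has integer coefficients and leading coefficient $1$. $\mathcal{M}_{k,h}(N)\subset\mathcal{M}(N)$ is the subset of forms of weight $k$ whose expansion at $i\infty$ is $q^{h}(1+O(q))$ ($h\in\mathbb Z$). Every $f\in\mathcal{M}_{k,h}(N)$ can be written as $f=q^h\prod_{n\ge1}(1-q^n)^{c(n)}$ with $c(n)\in\mathbb{Z}$. For $\gamma=\begin{psmallmatrix}a&b\\c&d\end{psmallmatrix}\in GL_2^+(\mathbb R)$, $(f|_k\gamma)(\tau)=\det(\gamma)^{k/2}(c\tau+d)^{-k}f(\gamma\tau)$. For a prime $p$, $r\ge1$ and $f\in\mathcal{M}(N)$ of weight $k$, the multiplicative Hecke operator is $$f|\mathcal{T}(p^{r}):=\begin{cases}\varepsilon\, p^{\frac{k}{1-p}\left(\frac{p^{r+1}-p}{p-1}-\frac{r}{2}(p^{r+1}+1)\right)}\prod_{ad=p^{r},\,0\le b<d}f|_{k}\begin{pmatrix}a&b\\0&d\end{pmatrix}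 & p\nmid N,\\ \varepsilon\, p^{\frac{rkp^{r}}{2}}\prod_{j=0}^{p^{r}-1}f|_{k}\begin{pmatrix}1&j\\0&p^{r}\end{pmatrix} & p\mid N,\end{cases}$$ where $a,d$ range over positive integers and $\varepsilon$ is the constant making the leading Fourier coefficient equal to $1$. $\sigma(n)$ is the sum of the positive divisors of $n$. *)

(* Defs.v *)
From HB Require Import structures.
From mathcomp Require Import all_boot all_order all_algebra.
From mathcomp Require Import all_classical all_reals all_analysis.
From mathcomp Require Import complex.

Set Implicit Arguments.
Unset Strict Implicit.
Unset Printing Implicit Defensive.

Import Order.TTheory GRing.Theory Num.Theory.
Import numFieldNormedType.Exports.

Local Open Scope classical_set_scope.
Local Open Scope ring_scope.
Local Open Scope complex_scope.

(* The topological notions are stated for K : numFieldType, whose topology is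
   that of its norm, and used with K = R[i]. *)
Section NumField.
Variable K : numFieldType.
Implicit Types (f g : K -> K) (u : nat -> K) (z l : K).

Definition tends_to u l : Prop := u @ \oo --> l.

(* Meromorphic functions on the upper half-plane are represented by total
   functions on R[i].  The values at isolated points (in particular at the
   poles) and outside the half-plane carry no information, so an identity
   between meromorphic functions is required on a punctured neighbourhood of
   every point of the half-plane. *)
Definition eq_mero_at f g z0 : Prop := \forall z \near z0^', f z = g z.

Definition meromorphic_at f z0 : Prop :=
  exists (m : nat) (g : K -> K),
    (\forall z \near z0, derivable g z 1) /\
    eq_mero_at f (fun z => g z / (z - z0) ^+ m) z0.

End NumField.

Section Analysis.
Variable R : realType.
Implicit Types (f g : R[i] -> R[i]) (z tau : R[i]).

Definition expC z : R[i] :=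
  (expR (complex.Re z))%:C * (cos (complex.Im z) +i* sin (complex.Im z)).

(* e^(2 pi i x tau), i.e. q^x for a real exponent x *)
Definition qpow (x : R) tau : R[i] := expC ((0 +i* (2 * pi * x)) * tau).

Definition q tau : R[i] := qpow 1 tau.

Definition near_ioo (P : R[i] -> Prop) : Prop :=
  exists Y : R, forall tau, Y < complex.Im tau -> P tau.

Definition meromorphic_upper f : Prop :=
  forall z0, 0 < complex.Im z0 -> meromorphic_at f z0.

Definition eq_mero_upper f g : Prop :=
  forall z0, 0 < complex.Im z0 -> eq_mero_at f g z0.

Definition has_q_expansion f (m : int) (a : nat -> R[i]) : Prop :=
  near_ioo (fun tau =>
    tends_to (series (fun n => a n * q tau ^ (m + n%:Z))) (f tau)).

(* Expansion in powers q^((n + kappa) / w), n = 0, 1, 2, ...: the real number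
   kappa accounts both for the order at infinity, which may be negative, and
   for the fractional part of the exponents caused by a multiplier system. *)
Definition meromorphic_at_ioo f : Prop :=
  exists (w : nat) (kappa : R) (a : nat -> R[i]), (0 < w)%N /\
    near_ioo (fun tau =>
      tends_to (series (fun n => a n * qpow ((n%:R + kappa) / w%:R) tau))
        (f tau)).

Definition has_product_expansion f (h : int) (c : nat -> int) : Prop :=
  near_ioo (fun tau =>
    tends_to
      (fun M => q tau ^ h * \prod_(1 <= n < M.+1) (1 - q tau ^+ n) ^ c n)
      (f tau)).

End Analysis.

Section ModularForms.
Variable R : realType.
Implicit Types (f : R[i] -> R[i]) (A : 'M[R]_2) (tau : R[i]).

Definition mx2 (T : Type) (a b c d : T) : 'M[T]_2 :=
  \matrix_(i < 2, j < 2)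
    if i == 0 then (if j == 0 then a else b) else (if j == 0 then c else d).

Definition cocycle A tau : R[i] := (A 1 0)%:C * tau + (A 1 1)%:C.

Definition moebius A tau : R[i] :=
  ((A 0 0)%:C * tau + (A 0 1)%:C) / cocycle A tau.

Definition slash (k : int) A f : R[i] -> R[i] := fun tau =>
  (\det A `^ (k%:~R / 2))%:C * cocycle A tau ^ (- k) * f (moebius A tau).

Definition SL2Z : set 'M[int]_2 := [set g | \det g = 1].

Definition Gamma0 (N : nat) : set 'M[int]_2 :=
  [set g | SL2Z g /\ (N%:Z %| g 1%R 0%R)%Z].

Definition toR (g : 'M[int]_2) : 'M[R]_2 := map_mx intr g.

Definition multiplier_system (N : nat) (chi : 'M[int]_2 -> R[i]) : Prop :=
  (forall g, Gamma0 N g -> `|chi g| = 1) /\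
  (forall g1 g2, Gamma0 N g1 -> Gamma0 N g2 ->
     chi (g1 *m g2) = chi g1 * chi g2).

(* Every cusp is g(i oo) for some g in SL_2(Z). *)
Definition mero_modular_form (N : nat) (k : int) f : Prop :=
  [/\ meromorphic_upper f,
      exists2 chi, multiplier_system N chi &
        forall g, Gamma0 N g ->
          eq_mero_upper (fun tau => f (moebius (toR g) tau))
            (fun tau => chi g * cocycle (toR g) tau ^ k * f tau)
    & forall g, SL2Z g -> meromorphic_at_ioo (slash k (toR g) f)].

(* f belongs to M_{k,h}(N) *)
Definition in_M (N : nat) (k h : int) f : Prop :=
  mero_modular_form N k f /\
  exists2 a : nat -> int, a 0%N = 1 &
    has_q_expansion f h (fun n => (a n)%:~R).

Definition leading_coef f (x : R[i]) : Prop :=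
  x != 0 /\ exists (m : int) (a : nat -> R[i]),
    a 0%N = x /\ has_q_expansion f m a.

Definition normalize f : R[i] -> R[i] :=
  let eps := xget 0 [set e : R[i] | leading_coef (fun tau => e * f tau) 1] in
  fun tau => eps * f tau.

(* f | T(p^r) at level N, for f of weight k *)
Definition hecke (N p r : nat) (k : int) f : R[i] -> R[i] :=
  let P : R := p%:R in
  let K : R := k%:~R in
  if (p %| N)%N then
    normalize (fun tau =>
      (P `^ (r%:R * K * P ^+ r / 2))%:C *
      \prod_(j < p ^ r) slash k (mx2 1 j%:R 0 (p ^ r)%:R) f tau)
  else
    normalize (fun tau =>
      (P `^ (K / (1 - P) *
             ((P ^+ r.+1 - P) / (P - 1) - r%:R / 2 * (P ^+ r.+1 + 1))))%:C *
      \prod_(d <- divisors (p ^ r)) \prod_(b < d)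
        slash k (mx2 (p ^ r %/ d)%:R b%:R 0 d%:R) f tau).

End ModularForms.

Section Exponents.
Local Open Scope nat_scope.

Definition sigma (n : nat) : nat := \sum_(d <- divisors n) d.

Definition chi_triv (p m : nat) : int := (coprime m p : nat)%:Z.

(* c~(X, Y / Z) *)
Definition ctilde (c : nat -> int) (X Y Z : nat) : int :=
  if Z %| Y then c (X * Y %/ Z) else 0%R.

(* When n / p^(r-j-1) is not an integer, the value of [chi_triv] at the
   truncated quotient is irrelevant: the factor [ctilde] vanishes. *)
Definition hecke_exp_ndvd (p r : nat) (c : nat -> int) (n : nat) : int :=
  (\sum_(i < r.+1) (p ^ i)%:Z * ctilde c (p ^ i) n (p ^ (r - i)) +
   \sum_(j < r) \sum_(i < j.+1)
     chi_triv p (n %/ p ^ (r - j - 1)) * (p ^ i)%:Z *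
     ctilde c (p ^ i) n (p ^ (r - j - 1)))%R.

Definition hecke_exp_dvd (p r : nat) (c : nat -> int) (n : nat) : int :=
  ((p ^ r)%:Z * ctilde c (p ^ r) n 1 +
   \sum_(i < r) chi_triv p n * (p ^ i)%:Z * ctilde c (p ^ i) n 1)%R.

End Exponents.

(* Main.v *)
(* Both products run over the upper triangular representatives (a b; 0 d) of the
   classes Gamma_0(N)\M, where M consists of the matrices g (a b; 0 d) with g in
   Gamma_0(N), ad = p^r, and moreover a = 1 if p | N.  Right multiplication by
   Gamma_0(N) permutes these classes, which gives the transformation law.  For g
   in SL_2(Z), (a b; 0 d) g = g' (a' b'; 0 d') with g' in SL_2(Z), so that the
   expansion at a cusp is a product of rescaled expansions of f at other cusps.
   At i oo, the product over b of the factors 1 - e(nb/d) q^(na/d) equals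
   (1 - q^(na/g))^g with g = gcd(n, d); collecting the exponents of each 1 - q^m
   gives the formula for the new exponents.  The rearrangement converges because
   the c(n) grow at most exponentially: f does not vanish near i oo, so
   consecutive partial products have quotient (1 - q^n)^c(n) -> 1.  The same bound
   turns an infinite product with integer exponents into a power series with
   integer coefficients. *)

Require Import Defs.
From HB Require Import structures.
From mathcomp Require Import all_boot all_order all_algebra.
From mathcomp Require Import all_classical all_reals all_analysis.
From mathcomp Require Import complex zify ring lra.

Set Implicit Arguments.
Unset Strict Implicit.
Unset Printing Implicit Defensive.

Import Order.TTheory GRing.Theory Num.Theory.
Import numFieldNormedType.Exports.

Local Open Scope classical_set_scope.
Local Open Scope ring_scope.
Local Open Scope complex_scope.

(** Triangular matrices have a constant automorphy factor, so the operator is a constant times a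
    product of values of [f] at affine points. Every constant is absorbed by [normalize]; but the
    latter picks its factor by choice, hence a uniqueness statement for leading coefficients must
    come before any identity for the operator. Two obstacles shape the rest. The multiplier of the
    image has to be a homomorphism, so a permutation of the classes is not enough: the elements of
    Gamma_0(N) that accompany it must satisfy a cocycle relation, and this comes from the uniqueness
    of the Hermite form. Moreover, the only convergence given is that of partial products in their
    natural order. Each exchange of limits therefore compares two truncations by a finite identity,
    up to an error that is small once |c(n)| rho^n <= 1 and |X| is at most rho/4 or rho^d/4. The
    number rho is found on the imaginary axis, where q is real; for the image it is found again in
    the same way rather than estimated from the formula for the new exponents. *)

Lemma ord2P (i : 'I_2) : i = 0 \/ i = 1.
Proof. by case: i => [[|[|//]] ?]; [left|right]; apply/val_inj. Qed.

(** * Integer matrices of size 2 and their Hermite form *)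

Section Matrices.
Variable T : pzRingType.

Lemma mx2E (a b c d : T) :
  (mx2 a b c d 0 0 = a) * (mx2 a b c d 0 1 = b) *
  (mx2 a b c d 1 0 = c) * (mx2 a b c d 1 1 = d).
Proof. by rewrite !mxE. Qed.

Lemma mx2_eta (A : 'M[T]_2) : A = mx2 (A 0 0) (A 0 1) (A 1 0) (A 1 1).
Proof.
by apply/matrixP => i j; have [->|->] := ord2P i; have [->|->] := ord2P j; rewrite mx2E.
Qed.

Lemma mx2P (A B : 'M[T]_2) : A 0 0 = B 0 0 -> A 0 1 = B 0 1 -> A 1 0 = B 1 0 ->
  A 1 1 = B 1 1 -> A = B.
Proof. by move=> h1 h2 h3 h4; rewrite (mx2_eta A) (mx2_eta B) h1 h2 h3 h4. Qed.

Lemma mulmx2E (A B : 'M[T]_2) i j : (A *m B) i j = A i 0 * B 0 j + A i 1 * B 1 j.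
Proof. by rewrite mxE big_ord_recl big_ord1; congr (_ + A i _ * B _ j); apply/val_inj. Qed.

End Matrices.

Lemma det2E (T : comPzRingType) (A : 'M[T]_2) : \det A = A 0 0 * A 1 1 - A 0 1 * A 1 0.
Proof. rewrite (expand_det_row _ 0) !big_ord_recl big_ord0 /cofactor !det_mx11 !mxE /=.
rewrite /bump /= expr0 mul1r addr0 expr1 mulN1r mulrN.
by congr (A _ _ * A _ _ - A _ _ * A _ _); apply/val_inj. Qed.

Definition upper_rep (n : nat) (x : nat * nat) : 'M[int]_2 :=
  mx2 (n %/ x.1)%N%:Z x.2%:Z 0 x.1%:Z.

Lemma det_upper_rep n x : (x.1 %| n)%N -> \det (upper_rep n x) = n%:Z.
Proof. by move=> dn; rewrite det2E !mx2E mulr0 subr0 -PoszM divnK. Qed.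

(** Row reduction: a Bézout relation for the first column clears the lower left entry and leaves the
    triangular matrix (a e; 0 d), whose upper right entry is then reduced modulo [d]. As [a] is a
    gcd and a d = n > 0, both diagonal entries are positive. *)
Lemma hermite_form (n : nat) (A : 'M[int]_2) : (0 < n)%N -> \det A = n%:Z ->
  exists g x, [/\ \det g = 1, (x.1 %| n)%N, (x.2 < x.1)%N &
    A = g *m upper_rep n x].
Proof.
move=> n0; rewrite det2E => detA.
have [u [v uv]] := Bezoutz (A 0 0) (A 1 0).
set a := gcdz _ _ in uv.
have /dvdzP[al Ha] : (a %| A 0%R 0%R)%Z by exact: dvdz_gcdl.
have /dvdzP[ga Hg] : (a %| A 1%R 0%R)%Z by exact: dvdz_gcdr.
pose d := al * A 1 1 - A 0 1 * ga.
have Ed : a * d = n%:Z by rewrite -detA Ha Hg /d; ring.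
have a0 : a != 0 by apply: contraTneq n0 => az; move: Ed; rewrite az mul0r; lia.
have uv1 : u * al + v * ga = 1.
  by apply: (mulfI a0); rewrite mulr1 -[RHS]uv Ha Hg; ring.
have [a' Ea] : exists a' : nat, a = a'%:Z by exists `|a|%N; rewrite /a /gcdz absz_nat.
have d0 : 0 < d.
  have : 0 < a * d by rewrite Ed; lia.
  by rewrite Ea pmulr_rgt0//; move: a0; rewrite Ea; lia.
have [d' Ed'] : exists d' : nat, d = d'%:Z by exists `|d|%N; rewrite gtz0_abs.
have En : (a' * d')%N = n by apply/eqP; rewrite -eqz_nat PoszM -Ea -Ed' Ed.
pose e := u * A 0 1 + v * A 1 1.
have dn0 : d != 0 by rewrite gt_eqF.
have eb0 := modz_ge0 e dn0; have ebd := ltz_pmod e d0.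
have [b Eb] : exists b : nat, (e %% d)%Z = b%:Z by exists `|(e %% d)%Z|%N; rewrite gez0_abs.
have Ee : b%:Z = e - (e %/ d)%Z * d by rewrite -Eb {2}(divz_eq e d); ring.
(* The inverse of the reduction: (al -v; ga u) inverts (u v; -ga al), and the shear by [e %/ d]
   restores the unreduced entry. *)
exists (mx2 al (- v + al * (e %/ d)%Z) ga (u + ga * (e %/ d)%Z)), (d', b); split => /=.
- by rewrite det2E !mx2E -uv1; ring.
- by rewrite -En dvdn_mull.
- by move: ebd; rewrite Eb Ed'; lia.
- have d'0 : (0 < d')%N by move: d0; rewrite Ed'.
  have aux1 : (al * u + v * ga) = 1 by rewrite -uv1; ring.
  have -> : (upper_rep n (d', b)) = mx2 a (e - (e %/ d)%Z * d) 0 d.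
    by rewrite /upper_rep /= -En mulnK// Ee -Ea -Ed'.
  apply: mx2P; rewrite mulmx2E !mx2E.
  + by rewrite mulr0 addr0.
  + rewrite -[LHS]mulr1 -aux1 /e /d; ring.
  + by rewrite mulr0 addr0.
  + rewrite -[LHS]mulr1 -aux1 /e /d; ring.
Qed.

(** The lower left entry of [g] vanishes because n/d is nonzero; positive diagonals then make [g]
    unipotent, and the bounds on the upper right entries kill the remaining shear. *)
Lemma upper_rep_stab (n : nat) (g : 'M[int]_2) (x y : nat * nat) : (0 < n)%N ->
  \det g = 1 -> (x.1 %| n)%N -> (x.2 < x.1)%N -> (y.1 %| n)%N -> (y.2 < y.1)%N ->
  g *m upper_rep n x = upper_rep n y -> x = y /\ g = 1%:M.
Proof.
case: x y => [d b] [d' b'] n0 /= detg /dvdnP[a Ea] bd /dvdnP[a' Ea'] bd' E.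
have E00 := congr1 (fun A => fun_of_matrix A 0 0) E.
have E01 := congr1 (fun A => fun_of_matrix A 0 1) E.
have E10 := congr1 (fun A => fun_of_matrix A 1 0) E.
have E11 := congr1 (fun A => fun_of_matrix A 1 1) E.
have d0 : (0 < d)%N by exact: leq_ltn_trans bd.
have d'0 : (0 < d')%N by exact: leq_ltn_trans bd'.
move: E00 E01 E10 E11; rewrite /upper_rep !mulmx2E !mx2E /= {1 3}Ea Ea' !mulnK//.
rewrite !mulr0 !addr0 => E00 E01 E10 E11.
have a0 : a%:Z != 0 by move: n0; rewrite Ea; case: (a).
have a'0 : a'%:Z != 0 by move: n0; rewrite Ea'; case: (a').
move/eqP: E10; rewrite mulf_eq0 (negPf a0) orbF => /eqP g10.
move: detg; rewrite det2E g10 mulr0 subr0 => g1.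
have g00 : 0 < g 0 0.
  have : 0 < g 0 0 * a%:Z by rewrite E00; move: a'0; lia.
  by rewrite pmulr_lgt0//; move: a0; lia.
have g11 : g 1 1 = 1.
  have h : 0 < g 1 1 by rewrite -(pmulr_rgt0 _ g00) g1.
  by nia.
move: g1; rewrite g11 mulr1 => g00'.
move: E11; rewrite g10 g11 mul0r add0r mul1r => -[Ed].
move: E01; rewrite g00' mul1r => E01.
have g01 : g 0 1 = 0.
  subst d'; have [//|h|h] := ltgtP (g 0 1) 0; nia.
move: E01; rewrite g01 mul0r addr0 => -[Eb].
split; first by rewrite Ed Eb.
by apply: mx2P; rewrite ?g00' ?g01 ?g10 ?g11 !mxE.
Qed.

(** Both conclusions serve later: x = y gives injectivity of the action on classes, g1 = g2 the
    cocycle relation between transition matrices. *)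
Lemma upper_rep_uniq (n : nat) (g1 g2 : 'M[int]_2) (x y : nat * nat) : (0 < n)%N ->
  \det g1 = 1 -> \det g2 = 1 ->
  (x.1 %| n)%N -> (x.2 < x.1)%N -> (y.1 %| n)%N -> (y.2 < y.1)%N ->
  g1 *m upper_rep n x = g2 *m upper_rep n y -> x = y /\ g1 = g2.
Proof.
move=> n0 d1 d2 x1 x2 y1 y2 E.
have u2 : g2 \in unitmx by rewrite unitmxE d2 unitr1.
have dg : \det (invmx g2 *m g1) = 1 by rewrite det_mulmx det_inv d1 d2 mulr1 invr1.
have E' : (invmx g2 *m g1) *m upper_rep n x = upper_rep n y.
  by rewrite -mulmxA E mulmxA mulVmx// mul1mx.
have [-> E2] := upper_rep_stab n0 dg x1 x2 y1 y2 E'.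
by split=> //; rewrite -[g2]mulmx1 -E2 mulmxA mulmxV// mul1mx.
Qed.

(** * Representatives of the Hecke classes and the action of Gamma_0(N) *)

(** The cases p | N and p not dividing N differ only in the admissible lower right entries; most of
    what follows is uniform in this list. *)
Definition hecke_dens (N p r : nat) : seq nat :=
  if (p %| N)%N then [:: (p ^ r)%N] else divisors (p ^ r).

Definition hecke_reps (N p r : nat) : seq (nat * nat) :=
  [seq (d, b) | d <- hecke_dens N p r, b <- iota 0 d].

Section Cosets.
Variables N p r : nat.
Hypothesis pp : prime p.
Let n := (p ^ r)%N.
Let n0 : (0 < n)%N. Proof. by rewrite expn_gt0 prime_gt0. Qed.

Lemma mem_hecke_reps x : (x \in hecke_reps N p r) = (x.1 \in hecke_dens N p r) && (x.2 < x.1)%N.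
Proof.
case: x => d b; apply/allpairsPdep/andP => [[d' [b' [hd hb [-> ->]]]]|[hd hb]].
  by rewrite mem_iota in hb.
by exists d, b; rewrite mem_iota.
Qed.

Lemma uniq_hecke_reps : uniq (hecke_reps N p r).
Proof.
apply: allpairs_uniq_dep.
- by rewrite /hecke_dens; case: ifP => // _; exact: divisors_uniq.
- by move=> d _; exact: iota_uniq.
- by move=> [a b] [c d] _ _ [-> ->].
Qed.

Lemma hecke_dens_dvd d : d \in hecke_dens N p r -> (d %| n)%N.
Proof.
by rewrite /hecke_dens; case: ifP => _; [rewrite inE => /eqP ->|rewrite -dvdn_divisors].
Qed.

Lemma hecke_reps_dvd x : x \in hecke_reps N p r -> (x.1 %| n)%N /\ (x.2 < x.1)%N.
Proof. by rewrite mem_hecke_reps => /andP[/hecke_dens_dvd]. Qed.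

Lemma Gamma0M g h : Gamma0 N g -> Gamma0 N h -> Gamma0 N (g *m h).
Proof.
rewrite /Gamma0 /SL2Z /= => -[dg Ng] [dh Nh]; split.
  by rewrite det_mulmx dg dh mulr1.
by rewrite mulmx2E rpredD//; [exact: dvdz_mulr|exact: dvdz_mull].
Qed.

(** Everything is read off the first columns, with [a] the upper left entry of the new triangular
    matrix. If p does not divide N, then [a] is a power of p prime to N, and N divides [a] times the
    lower left entry of [g']. If p | N, a factor p of [a] would divide the whole first column of
    [g], hence its determinant 1; so a = 1, as the list requires. *)
Lemma hecke_coset g x : Gamma0 N g -> x \in hecke_reps N p r ->
  exists g' y, [/\ Gamma0 N g', y \in hecke_reps N p r &
    upper_rep n x *m g = g' *m upper_rep n y].
Proof.
move=> [detg Ng] xr; have [xn xb] := hecke_reps_dvd xr.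
have detM : \det (upper_rep n x *m g) = n%:Z by rewrite det_mulmx det_upper_rep// detg mulr1.
have [g' [y [detg' yn yb E]]] := hermite_form n0 detM.
exists g', y.
have E00 := congr1 (fun A => fun_of_matrix A 0 0) E.
have E10 := congr1 (fun A => fun_of_matrix A 1 0) E.
move: E00 E10; rewrite !mulmx2E /upper_rep !mx2E /= mul0r add0r !mulr0 !addr0.
set a := (n %/ y.1)%N => E00 E10.
have an : (a %| n)%N by rewrite /a -{2}(divnK yn) dvdn_mulr.
have /dvdn_pfactor : (a %| p ^ r)%N by [].
move=> /(_ pp)[s sr Ea].
have Ny : (y.1 = n %/ a)%N by rewrite /a divnA// mulKn.
have [pN|pN] := boolP (p %| N)%N.
  have xE : x.1 = n.
    by move: xr; rewrite mem_hecke_reps /hecke_dens pN inE => /andP[/eqP].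
  have pg : (p%:Z %| g 1%R 0%R)%Z by apply: dvdz_trans Ng; rewrite dvdzE.
  have a1 : a = 1%N.
    rewrite Ea; case: s sr Ea => // s sr Ea; exfalso.
    have pa : (p%:Z %| a%:Z)%Z by rewrite dvdzE /= Ea expnS dvdn_mulr.
    have h1 : (p%:Z %| g 0%R 0%R)%Z.
      have : (p%:Z %| (g' 0 0 * a%:Z)%R)%Z by exact: dvdz_mull.
      rewrite -E00 xE divnn n0 mul1r rpredDr//; exact: dvdz_mull.
    have : (p%:Z %| \det g)%Z by rewrite det2E rpredB//; [exact: dvdz_mulr|exact: dvdz_mull].
    by rewrite detg dvdzE /= dvdn1; move/eqP => p1; have := prime_gt1 pp; rewrite p1.
  split=> //.
    by split=> //; have -> : g' 1 0 = x.1%:Z * g 1 0 by [rewrite E10 a1 mulr1]; exact: dvdz_mull.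
  by rewrite mem_hecke_reps yb andbT /hecke_dens pN inE Ny a1 divn1.
split=> //.
  split=> //.
  have cNa : coprimez N%:Z a%:Z.
    by rewrite /coprimez /gcdz /= Ea eqz_nat; apply: coprimeXr; rewrite coprime_sym prime_coprime.
  by rewrite -(Gauss_dvdzl _ cNa) -E10 dvdz_mull.
by rewrite mem_hecke_reps yb andbT /hecke_dens (negPf pN) -dvdn_divisors.
Qed.

(** [s g] is the right action of [g] on the classes, [t g x] the transition matrix. Injectivity
    comes from multiplying back by the inverse of [g], surjectivity from counting. The last clause
    is what will make the product of the chi (t g x) multiplicative in [g]. *)
Lemma hecke_permutation : exists (s : 'M[int]_2 -> nat * nat -> nat * nat)
    (t : 'M[int]_2 -> nat * nat -> 'M[int]_2),
  [/\ forall (g : 'M[int]_2) (x : nat * nat), Gamma0 N g -> x \in hecke_reps N p r ->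
        [/\ Gamma0 N (t g x), s g x \in hecke_reps N p r &
            upper_rep n x *m g = t g x *m upper_rep n (s g x)],
      forall g, Gamma0 N g ->
        perm_eq [seq s g x | x <- hecke_reps N p r] (hecke_reps N p r) &
      forall g h x, Gamma0 N g -> Gamma0 N h -> x \in hecke_reps N p r ->
        t (g *m h) x = t g x *m t h (s g x)].
Proof.
have /choice[F HF] : forall gx : 'M[int]_2 * (nat * nat),
    exists h : 'M[int]_2 * (nat * nat), Gamma0 N gx.1 -> gx.2 \in hecke_reps N p r ->
    [/\ Gamma0 N h.1, h.2 \in hecke_reps N p r &
            upper_rep n gx.2 *m gx.1 = h.1 *m upper_rep n h.2].
  move=> [g x] /=; have [[Gg xr]|H] := pselect (Gamma0 N g /\ x \in hecke_reps N p r).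
    by have [g' [y H]] := hecke_coset Gg xr; exists (g', y).
  by exists (g, x) => Gg xr; exfalso; apply: H.
pose s g x := (F (g, x)).2; pose t g x := (F (g, x)).1.
have H g x : Gamma0 N g -> x \in hecke_reps N p r ->
        [/\ Gamma0 N (t g x), s g x \in hecke_reps N p r &
            upper_rep n x *m g = t g x *m upper_rep n (s g x)] by exact: (HF (g, x)).
exists s, t; split=> //.
- move=> g Gg; have inj : {in hecke_reps N p r &, injective (s g)}.
    move=> x y xr yr E; have [G1 _ E1] := H g x Gg xr; have [G2 _ E2] := H g y Gg yr.
    have [xn xb] := hecke_reps_dvd xr; have [yn yb] := hecke_reps_dvd yr.
    have ug : g \in unitmx by rewrite unitmxE (proj1 Gg) unitr1.
    have u1 : t g x \in unitmx by rewrite unitmxE (proj1 G1) unitr1.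
    have u2 : t g y \in unitmx by rewrite unitmxE (proj1 G2) unitr1.
    have dV (A : 'M[int]_2) : \det A = 1 -> \det (invmx A) = 1 :> int.
      by move=> dA; rewrite det_inv dA invr1.
    have E3 : invmx (t g x) *m upper_rep n x = invmx (t g y) *m upper_rep n y.
      apply: (can_inj (mulmxK ug)); rewrite -!mulmxA E1 E2 !mulmxA !mulVmx//.
      by rewrite !mul1mx E.
    have [-> //] := upper_rep_uniq n0 (dV _ (proj1 G1)) (dV _ (proj1 G2)) xn xb yn yb E3.
  have us : uniq [seq s g x | x <- hecke_reps N p r] by rewrite map_inj_in_uniq// uniq_hecke_reps.
  apply: uniq_perm => //; first exact: uniq_hecke_reps.
  have sub : {subset [seq s g x | x <- hecke_reps N p r] <= hecke_reps N p r}.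
    by move=> y /mapP[x xr ->]; have [] := H g x Gg xr.
  by have [] := uniq_min_size us sub; rewrite ?size_map.
- move=> g h x Gg Gh xr.
  have [G1 s1 E1] := H g x Gg xr; have [G2 s2 E2] := H h _ Gh s1.
  have [G3 s3 E3] := H (g *m h) x (Gamma0M Gg Gh) xr.
  have E4 : t (g *m h) x *m upper_rep n (s (g *m h) x) =
      (t g x *m t h (s g x)) *m upper_rep n (s h (s g x)).
    by rewrite -E3 mulmxA E1 -mulmxA E2 mulmxA.
  have [xn xb] := hecke_reps_dvd s3; have [yn yb] := hecke_reps_dvd s2.
  by have [_ ->] := upper_rep_uniq n0 (proj1 G3) (proj1 (Gamma0M G1 G2)) xn xb yn yb E4.
Qed.

End Cosets.

(** * The exponent formulas *)

(** Contribution of a single denominator [d], with a = p^r / d, to the exponent of 1 - q^m. The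
    condition is n a / gcd(n, d) = m, cleared of its division; for a > 0 it implies n <= m d, so the
    range of the sum cuts nothing off. *)
Definition channel_exp (a d : nat) (c : nat -> int) (m : nat) : int :=
  \sum_(1 <= n < (m * d).+1 | (n * a == m * gcdn n d)%N) (gcdn n d)%:Z * c n.

Section Exponents.
Variables (p : nat) (c : nat -> int).
Hypothesis pp : prime p.

(** If gcd(n, p^s) = p^i, the condition on [n] reads n = p^i m', where m' = m / p^e has to be an
    integer. For i = s such an [n] always has the right gcd; for i < s it does exactly when p does
    not divide m', which is where the character comes from. *)
Lemma channel_exp_primepow e s m : (0 < m)%N ->
  channel_exp (p ^ e) (p ^ s) c m =
  (p ^ s)%:Z * ctilde c (p ^ s) m (p ^ e) +
  \sum_(i < s) chi_triv p (m %/ p ^ e) * (p ^ i)%:Z * ctilde c (p ^ i) m (p ^ e).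
Proof.
move=> m0; have pe0 : (0 < p ^ e)%N by rewrite expn_gt0 prime_gt0.
rewrite /channel_exp /ctilde.
have [/dvdnP[m' Em]|ndvd] := boolP (p ^ e %| m)%N; last first.
  rewrite mulr0 add0r [RHS]big1; last by move=> i _; rewrite mulr0.
  rewrite big_pred0// => n; apply/negP => /eqP E.
  have /dvdnP[n' En] := dvdn_gcdl n (p ^ s)%N.
  have g0 : (0 < gcdn n (p ^ s))%N by rewrite gcdn_gt0 expn_gt0 (prime_gt0 pp) orbT.
  move: E; rewrite {1}En mulnAC => /eqP; rewrite eqn_pmul2r// => /eqP E.
  by move: ndvd; rewrite -E dvdn_mull.
have m'0 : (0 < m')%N by move: m0; rewrite Em muln_gt0 => /andP[].
have cE i : c (p ^ i * m %/ p ^ e)%N = c (p ^ i * m')%N by rewrite Em mulnA mulnK.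
have Emd : (m %/ p ^ e = m')%N by rewrite Em mulnK.
rewrite cE; under [in RHS]eq_bigr do rewrite cE Emd.
transitivity (\sum_(1 <= n < (m * p ^ s).+1) \sum_(i < s.+1)
    (if (gcdn n (p ^ s) == p ^ i)%N && (n == p ^ i * m')%N then (p ^ i)%:Z * c n else 0)).
  rewrite big_mkcond; apply: eq_bigr => n _.
  have /(dvdn_pfactor _ _ pp)[j js Ej] := dvdn_gcdr n (p ^ s)%N.
  rewrite (bigD1 (Ordinal (js : (j < s.+1)%N)))//= Ej eqxx /= big1; last first.
    move=> i ij; rewrite eqn_exp2l ?prime_gt1// ifF//.
    by apply: contraNF ij => /andP[/eqP ji _]; apply/eqP/val_inj.
  rewrite addr0 Em; have -> : (n * p ^ e == m' * p ^ e * p ^ j)%N = (n == p ^ j * m')%N; last by [].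
  by rewrite mulnAC eqn_pmul2r// mulnC.
rewrite exchange_big /=.
have inner (i : 'I_s.+1) : \sum_(1 <= n < (m * p ^ s).+1)
    (if (gcdn n (p ^ s) == p ^ i)%N && (n == p ^ i * m')%N then (p ^ i)%:Z * c n else 0)
  = if (gcdn (p ^ i * m') (p ^ s) == p ^ i)%N then (p ^ i)%:Z * c (p ^ i * m')%N else 0.
  rewrite (bigD1_seq (p ^ i * m')%N) ?iota_uniq//=; last first.
    rewrite mem_index_iota muln_gt0 m'0 expn_gt0 prime_gt0//= ltnS Em mulnC.
    by rewrite leq_mul ?leq_pmulr// leq_pexp2l ?prime_gt0// -ltnS.
  rewrite eqxx andbT big1 ?addr0// => k ki.
  by rewrite (negPf ki) andbF.
under eq_bigr do rewrite inner.
rewrite big_ord_recr /= addrC.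
have -> : (gcdn (p ^ s * m') (p ^ s) == p ^ s)%N by apply/eqP/gcdn_idPr; exact: dvdn_mulr.
congr (_ + _); apply: eq_bigr => i _.
have -> : (gcdn (p ^ i * m') (p ^ s) == p ^ i)%N = coprime p m'.
  move: (nat_of_ord i) (ltn_ord i) => j js.
  rewrite -(subnKC (ltnW js)) expnD -muln_gcdr -{2}[(p ^ j)%N]muln1.
  rewrite eqn_pmul2l ?expn_gt0 ?prime_gt0// -/(coprime _ _).
  by rewrite coprime_sym coprime_pexpl// subn_gt0.
rewrite /chi_triv coprime_sym; case: (coprime m' p).
  by rewrite -[Posz true]/(1 : int) mul1r.
by rewrite -[Posz false]/(0 : int) !mul0r.
Qed.

Lemma perm_divisors_primepow r : perm_eq (divisors (p ^ r)) [seq (p ^ i)%N | i <- iota 0 r.+1].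
Proof.
apply: uniq_perm; first exact: divisors_uniq.
  by rewrite map_inj_uniq ?iota_uniq// => i j /eqP; rewrite eqn_exp2l ?prime_gt1// => /eqP.
move=> d; rewrite -dvdn_divisors ?expn_gt0 ?prime_gt0//.
apply/(dvdn_pfactor _ _ pp)/mapP => [[i ir ->]|[k]].
  by exists i; rewrite // mem_iota.
by rewrite mem_iota => kr ->; exists k.
Qed.

Lemma hecke_exp_dvdE r m : (0 < m)%N ->
  hecke_exp_dvd p r c m = channel_exp (p ^ r %/ p ^ r) (p ^ r) c m.
Proof.
move=> m0; rewrite divnn expn_gt0 prime_gt0//= -(expn0 p) channel_exp_primepow//.
by rewrite expn0 divn1.
Qed.

Lemma hecke_exp_ndvdE r m : (0 < m)%N ->
  hecke_exp_ndvd p r c m = \sum_(d <- divisors (p ^ r)) channel_exp (p ^ r %/ d) d c m.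
Proof.
move=> m0; rewrite (perm_big _ (perm_divisors_primepow r)) big_map.
rewrite -[iota 0 r.+1]/(index_iota 0 r.+1) big_mkord.
have E (s : 'I_r.+1) : channel_exp (p ^ r %/ p ^ s) (p ^ s) c m =
  (p ^ s)%:Z * ctilde c (p ^ s) m (p ^ (r - s)) +
  \sum_(i < s) chi_triv p (m %/ p ^ (r - s)) * (p ^ i)%:Z * ctilde c (p ^ i) m (p ^ (r - s)).
  by rewrite -expnB ?prime_gt0 -1?ltnS// channel_exp_primepow.
under eq_bigr do rewrite E.
rewrite big_split /=; congr (_ + _).
(* The denominator p^0 has an empty inner sum; the others are re-indexed by s = j + 1. *)
rewrite [RHS]big_ord_recl big_ord0 add0r; apply: eq_bigr => j _ /=.
by have -> : bump 0 j = j.+1 by []; rewrite -subnDA addn1.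
Qed.

End Exponents.

(** * Limits and complex absolute values *)

Section Limits.
Variable K : numFieldType.
Implicit Types (l m : K) (u v : nat -> K).

Lemma tends_toM u v l m : tends_to u l -> tends_to v m ->
  tends_to (fun n => u n * v n) (l * m).
Proof. by move=> ul vm; exact: cvgM. Qed.

Lemma tends_toD u v l m : tends_to u l -> tends_to v m ->
  tends_to (fun n => u n + v n) (l + m).
Proof. by move=> ul vm; exact: cvgD. Qed.

Lemma tends_toV u l : l != 0 -> tends_to u l -> tends_to (fun n => (u n)^-1) l^-1.
Proof. by move=> l0 ul; exact: cvgV. Qed.

Lemma tends_to_cst l : tends_to (fun=> l) l.
Proof. exact: cvg_cst. Qed.

Lemma tends_toMl a u l : tends_to u l -> tends_to (fun n => a * u n) (a * l).
Proof. by move=> ul; apply: tends_toM ul; exact: tends_to_cst. Qed.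

Lemma tends_to_prod (I : eqType) (s : seq I) (u : I -> nat -> K) (l : I -> K) :
  (forall i, i \in s -> tends_to (u i) (l i)) ->
  tends_to (fun n => \prod_(i <- s) u i n) (\prod_(i <- s) l i).
Proof.
elim: s => [|i s IH] ul.
  by rewrite big_nil; under eq_fun do rewrite big_nil; exact: tends_to_cst.
rewrite big_cons; under eq_fun do rewrite big_cons.
apply: tends_toM; first by apply: ul; rewrite mem_head.
by apply: IH => j js; apply: ul; rewrite inE js orbT.
Qed.

Lemma tends_to_subseq u l (phi : nat -> nat) : tends_to u l ->
  (forall n, (n <= phi n)%N) -> tends_to (fun n => u (phi n)) l.
Proof.
move=> ul phin; apply: (cvg_comp phi u _ ul) => A [N _ NA].
by exists N => // n /= Nn; apply: NA => /=; apply: leq_trans Nn (phin n).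
Qed.

Lemma tends_to_subseqP u l (phi : nat -> nat) : tends_to u l ->
  phi @ \oo --> \oo -> tends_to (fun n => u (phi n)) l.
Proof. by move=> ul phin; exact: (cvg_comp phi u phin ul). Qed.

Lemma tends_to_eq u v l : u =1 v -> tends_to u l -> tends_to v l.
Proof. by move=> /funext ->. Qed.

Lemma tends_to_shift u l : tends_to (fun n => u n.+1) l <-> tends_to u l.
Proof. by rewrite /tends_to -(cvg_shiftS u). Qed.

End Limits.

Section RealNorm.
Variable R : realType.
Implicit Types (z w l m : R[i]) (u v : nat -> R[i]).

(** The norm of [R[i]] has values in [R[i]]; taking the real part gives access to real estimates and
    to [lra]. *)
Definition nrm z : R := complex.Re `|z|.

Lemma nrmE z : `|z| = (nrm z)%:C.
Proof. by []. Qed.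

Lemma nrm_ge0 z : 0 <= nrm z.
Proof. by rewrite -ler0c -nrmE. Qed.

Lemma nrmM z w : nrm (z * w) = nrm z * nrm w.
Proof. by apply: complexI; rewrite rmorphM -!nrmE normrM. Qed.

Lemma nrmV z : nrm z^-1 = (nrm z)^-1.
Proof. by apply: complexI; rewrite fmorphV -!nrmE normfV. Qed.

Lemma nrmX z n : nrm (z ^+ n) = nrm z ^+ n.
Proof. by apply: complexI; rewrite rmorphXn -!nrmE normrX. Qed.

Lemma nrmZ z (n : int) : nrm (z ^ n) = nrm z ^ n.
Proof. by case: n => n; rewrite ?NegzE -?exprnN ?nrmV nrmX. Qed.

Lemma nrmD z w : nrm (z + w) <= nrm z + nrm w.
Proof. by rewrite -lecR rmorphD -!nrmE ler_normD. Qed.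

Lemma nrmN z : nrm (- z) = nrm z.
Proof. by apply: complexI; rewrite -!nrmE normrN. Qed.

Lemma nrmB z w : nrm (z - w) = nrm (w - z).
Proof. by rewrite -nrmN opprB. Qed.

Lemma nrmR (x : R) : nrm x%:C = `|x|.
Proof. by rewrite /nrm /= expr0n addr0 sqrtr_sqr. Qed.

Lemma nrm1 : nrm 1 = 1.
Proof. by rewrite (nrmR 1) normr1. Qed.

Lemma nrm0 : nrm 0 = 0.
Proof. by rewrite (nrmR 0) normr0. Qed.

Lemma nrm_eq0 z : (nrm z == 0) = (z == 0).
Proof.
by rewrite -(inj_eq (@complexI R)) -nrmE normr_eq0.
Qed.

Lemma nrm_gt0 z : (0 < nrm z) = (z != 0).
Proof. by rewrite lt_def nrm_eq0 nrm_ge0 andbT. Qed.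

Lemma nrm_sum (I : Type) (r : seq I) (P : pred I) (F : I -> R[i]) :
  nrm (\sum_(i <- r | P i) F i) <= \sum_(i <- r | P i) nrm (F i).
Proof.
elim/big_ind2: _ => [|x a y b xa yb|//]; first by rewrite nrm0.
by apply: (le_trans (nrmD _ _)); rewrite lerD.
Qed.

Lemma nrm_intr (n : int) : nrm n%:~R = `|n|%:~R.
Proof. by rewrite -[n%:~R](rmorph_int (real_complex R)) nrmR intr_norm. Qed.

Lemma tends_toP u l : tends_to u l <-> (fun n => nrm (u n - l)) @ \oo --> (0 : R).
Proof.
split=> [ul|ul].
  apply/cvgrPdist_le => e e0.
  have ec : 0 < e%:C by rewrite ltcR.
  move/cvgrPdist_le : ul => /(_ _ ec); apply: filterS => n.
  by rewrite distrC nrmE lecR sub0r normrN ger0_norm// nrm_ge0.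
apply/cvgrPdist_le => e e0.
(* In the partial order of [R[i]] a positive element is real. *)
have [x x0 ->] : exists2 x : R, 0 < x & e = x%:C.
  case: e e0 => a b; rewrite ltcE /= => /andP[/eqP -> a0]; by exists a.
move/cvgrPdist_le : ul => /(_ _ x0); apply: filterS => n.
by rewrite sub0r normrN ger0_norm ?nrm_ge0// distrC nrmE lecR.
Qed.

Lemma tends_to_squeeze u l (v : nat -> R) :
  (\forall n \near \oo, nrm (u n - l) <= v n) -> v @ \oo --> (0 : R) -> tends_to u l.
Proof.
move=> uv v0; apply/tends_toP; apply: squeeze_cvgr (cvg_cst 0) v0.
by apply: filterS uv => n ->; rewrite nrm_ge0.
Qed.

Lemma tends_to_le u l e : 0 < e -> tends_to u l ->
  \forall n \near \oo, nrm (u n - l) <= e.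
Proof.
move=> e0 /tends_toP/cvgrPdist_le/(_ _ e0); apply: filterS => n.
by rewrite sub0r normrN ger0_norm ?nrm_ge0.
Qed.

Lemma tends_to_uniq u l m : tends_to u l -> tends_to u m -> l = m.
Proof.
move=> ul um; apply/eqP; rewrite -subr_eq0 -nrm_eq0; apply/eqP/le_anti.
rewrite nrm_ge0 andbT; apply/ler_addgt0Pl => e e0; rewrite addr0.
have e2 : 0 < e / 2 by rewrite divr_gt0.
near \oo => n.
have -> : l - m = (l - u n) + (u n - m) by ring.
apply: (le_trans (nrmD _ _)); rewrite (splitr e) lerD//.
  by rewrite nrmB; near: n; exact: tends_to_le e2 ul.
by near: n; exact: tends_to_le e2 um.
Unshelve. all: by end_near.
Qed.

End RealNorm.

(** * The functions q^x near i oo *)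

Section Exponential.
Variable R : realType.
Implicit Types (z w tau : R[i]) (x y : R).

Lemma expCD z w : expC (z + w) = expC z * expC w.
Proof.
case: z w => [a b] [c d]; rewrite /expC /= expRD cosD sinD.
by apply/eqP; rewrite eq_complex /=; apply/andP; split; apply/eqP; ring.
Qed.

Lemma expC0 : expC (0 : R[i]) = 1.
Proof.
by rewrite /expC /= expR0 cos0 sin0; apply/eqP; rewrite eq_complex /=; apply/andP; split; apply/eqP; ring.
Qed.

Lemma nrm_expC z : nrm (expC z) = expR (complex.Re z).
Proof.
rewrite /expC nrmM nrmR (ger0_norm (expR_ge0 _)).
by rewrite /nrm /= cos2Dsin2 sqrtr1 mulr1.
Qed.

Lemma qpowD x y tau : qpow (x + y) tau = qpow x tau * qpow y tau.
Proof.
rewrite /qpow -expCD -mulrDl; congr expC; congr (_ * _).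
by apply/eqP; rewrite eq_complex /=; apply/andP; split; apply/eqP; ring.
Qed.

Lemma qpow0 tau : qpow 0 tau = 1.
Proof. by rewrite /qpow !mulr0 -[0 +i* 0]/(0 : R[i]) mul0r expC0. Qed.

Lemma nrm_qpow x tau : nrm (qpow x tau) = expR (- (2 * pi * x * complex.Im tau)).
Proof.
rewrite nrm_expC; congr expR; case: tau => a b /=; ring.
Qed.

Lemma qpow_neq0 x tau : qpow x tau != 0.
Proof. by rewrite -nrm_gt0 nrm_qpow expR_gt0. Qed.

Lemma qpowX x tau n : qpow x tau ^+ n = qpow (n%:R * x) tau.
Proof.
elim: n => [|n IH]; first by rewrite expr0 mul0r qpow0.
by rewrite exprS IH -qpowD -(natr1 n) mulrDl mul1r addrC.
Qed.

Lemma qpowN x tau : qpow (- x) tau = (qpow x tau)^-1.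
Proof.
by apply: (mulfI (qpow_neq0 x tau)); rewrite -qpowD subrr qpow0 mulfV ?qpow_neq0.
Qed.

Lemma qpowZ x tau (n : int) : qpow x tau ^ n = qpow (n%:~R * x) tau.
Proof.
case: n => n; first by rewrite -exprnP qpowX.
by rewrite NegzE -exprnN qpowX -qpowN mulrNz mulNr.
Qed.

Lemma qX tau n : q tau ^+ n = qpow n%:R tau.
Proof. by rewrite /q qpowX mulr1. Qed.

Lemma qZ tau (n : int) : q tau ^ n = qpow n%:~R tau.
Proof. by rewrite /q qpowZ mulr1. Qed.

Lemma qpow_affine x a b tau :
  qpow x (a%:C * tau + b%:C) = qpow (x * a) tau * qpow x b%:C.
Proof.
rewrite /qpow -expCD; congr expC; case: tau => s t.
by apply/eqP; rewrite eq_complex /=; apply/andP; split; apply/eqP; ring.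
Qed.

Lemma qpowRM x y (z : R) : qpow (x * y) z%:C = qpow x (y * z)%:C.
Proof.
rewrite /qpow; congr expC.
by apply/eqP; rewrite eq_complex /=; apply/andP; split; apply/eqP; ring.
Qed.

Lemma qpow_nat (n : nat) : qpow (1 : R) (n%:R)%:C = 1.
Proof.
have h : qpow (1 : R) 1%:C = 1.
  have -> : qpow (1 : R) 1%:C = expC (0 +i* (pi *+ 2)).
    rewrite /qpow; congr expC; rewrite -mulr_natl.
    by apply/eqP; rewrite eq_complex /=; apply/andP; split; apply/eqP; ring.
  rewrite /expC /= expR0 cos2pi sin2pi.
  by apply/eqP; rewrite eq_complex /=; apply/andP; split; apply/eqP; ring.
elim: n => [|n IH]; first by rewrite /qpow (_ : (0%:R)%:C = 0) ?mulr0 ?expC0.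
have -> : (n.+1%:R)%:C = (1 : R)%:C * (n%:R)%:C + (1 : R)%:C :> R[i].
  by rewrite -natr1 rmorphD mul1r.
by rewrite qpow_affine mulr1 IH h mulr1.
Qed.

Lemma near_iooW (P Q : R[i] -> Prop) : (forall tau, P tau -> Q tau) ->
  near_ioo P -> near_ioo Q.
Proof. by move=> PQ [Y h]; exists Y => tau /h/PQ. Qed.

Lemma near_ioo_and (P Q : R[i] -> Prop) : near_ioo P -> near_ioo Q ->
  near_ioo (fun tau => P tau /\ Q tau).
Proof.
move=> [Y h] [Z k]; exists (Num.max Y Z) => tau; rewrite gt_max => /andP[? ?].
by split; [exact: h|exact: k].
Qed.

Lemma near_ioo_all (I : eqType) (s : seq I) (P : I -> R[i] -> Prop) :
  (forall i, i \in s -> near_ioo (P i)) ->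
  near_ioo (fun tau => forall i, i \in s -> P i tau).
Proof.
elim: s => [|i s IH] H; first by exists 0 => tau _ i; rewrite in_nil.
have Hs : near_ioo (fun tau => forall i, i \in s -> P i tau).
  by apply: IH => j js; apply: H; rewrite inE js orbT.
have := near_ioo_and (H i (mem_head _ _)) Hs.
apply: near_iooW => tau [Pi Ps] j; rewrite inE => /orP[/eqP -> //|]; exact: Ps.
Qed.

Lemma near_ioo_gt (Y : R) : near_ioo (fun tau => Y < complex.Im tau).
Proof. by exists Y. Qed.

Lemma Im_affine (a b : R) tau : complex.Im (a%:C * tau + b%:C) = a * complex.Im tau.
Proof. by case: tau => s t /=; ring. Qed.

Lemma near_ioo_affine (a b : R) (P : R[i] -> Prop) : 0 < a -> near_ioo P ->
  near_ioo (fun tau => P (a%:C * tau + b%:C)).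
Proof.
move=> a0 [Y h]; exists (Y / a) => tau Yt; apply: h.
by rewrite Im_affine mulrC -ltr_pdivrMr.
Qed.

Lemma near_ioo_small (x e : R) : 0 < x -> 0 < e ->
  near_ioo (fun tau => nrm (qpow x tau) < e).
Proof.
move=> x0 e0; have c0 : 0 < 2 * pi * x by rewrite !mulr_gt0// pi_gt0.
exists (- ln e / (2 * pi * x)) => tau.
rewrite ltr_pdivrMr// => h; rewrite nrm_qpow -[ltRHS](@lnK _ e)//.
by rewrite ltr_expR; lra.
Qed.

End Exponential.

Lemma exprz_absz (K : unitRingType) (y : K) (e : int) :
  y ^ e = (if 0 <= e then y else y^-1) ^+ `|e|%N.
Proof. by case: e => n; rewrite ?NegzE //= -exprnN exprVn. Qed.

(** * Products of factors close to 1, and growth of the exponents *)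

Section ProductEstimates.
Variable R : realType.
Implicit Types (x X A l : R[i]) (e : int).

Lemma nrm_prodB1 (I : Type) (s : seq I) (P : pred I) (y : I -> R[i]) :
  nrm (\prod_(i <- s | P i) y i - 1) <= \prod_(i <- s | P i) (1 + nrm (y i - 1)) - 1.
Proof.
suff : 1 <= \prod_(i <- s | P i) (1 + nrm (y i - 1)) /\
  nrm (\prod_(i <- s | P i) y i - 1) <= \prod_(i <- s | P i) (1 + nrm (y i - 1)) - 1 by case.
apply: (big_ind2 (fun (z : R[i]) (a : R) => 1 <= a /\ nrm (z - 1) <= a - 1)).
- by rewrite !subrr nrm0.
- move=> z a w b [a1 za] [b1 wb].
  split; first by rewrite -[1]mulr1 ler_pM.
  have -> : z * w - 1 = (z - 1) * (w - 1) + ((z - 1) + (w - 1)) by ring.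
  apply: (le_trans (nrmD _ _)); rewrite nrmM.
  have -> : a * b - 1 = (a - 1) * (b - 1) + ((a - 1) + (b - 1)) by ring.
  apply: lerD; first by rewrite ler_pM ?nrm_ge0.
  by apply: (le_trans (nrmD _ _)); exact: lerD.
- by move=> i _; have := nrm_ge0 (y i - 1); split; lra.
Qed.

Lemma nrm_1subV x : nrm x <= 2^-1 -> nrm ((1 - x)^-1 - 1) <= 2 * nrm x.
Proof.
move=> x2; have h : 2^-1 <= nrm (1 - x).
  have := nrmD (1 - x) x; rewrite subrK nrm1; lra.
have x1 : 1 - x != 0 by rewrite -nrm_gt0; lra.
have -> : (1 - x)^-1 - 1 = x * (1 - x)^-1 by field.
rewrite nrmM nrmV mulrC ler_wpM2r ?nrm_ge0//.
by rewrite -(invrK 2) lef_pV2 ?posrE//; lra.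
Qed.

(** The factor 2 pays for negative exponents, where 1 - x is replaced by its inverse, so that one
    bound covers both signs. *)
Lemma nrm_factorB1 x e : nrm x <= 2^-1 ->
  nrm ((1 - x) ^ e - 1) <= expR (2 * nrm x * (`|e|%N)%:R) - 1.
Proof.
move=> x2; rewrite exprz_absz; set y := (if _ then _ else _).
have hy : nrm (y - 1) <= 2 * nrm x.
  rewrite /y; case: ifP => _; last exact: nrm_1subV.
  by rewrite addrAC subrr sub0r nrmN; have := nrm_ge0 x; lra.
have -> : y ^+ `|e| = \prod_(i < `|e|) y by rewrite prodr_const card_ord.
apply: (le_trans (nrm_prodB1 _ _ _)); rewrite prodr_const card_ord lerD2r.
rewrite mulrC expRM_natl; apply: lerXn2r; rewrite ?nnegrE ?expR_ge0//.
  by have := nrm_ge0 (y - 1); lra.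
by apply: le_trans (expR_ge1Dx _); lra.
Qed.

Lemma nrm_factorsB1 (I : eqType) (s : seq I) (P : pred I) (x : I -> R[i]) (e : I -> int) :
  (forall i, i \in s -> P i -> nrm (x i) <= 2^-1) ->
  nrm (\prod_(i <- s | P i) (1 - x i) ^ (e i) - 1) <=
  expR (\sum_(i <- s | P i) 2 * nrm (x i) * (`|e i|%N)%:R) - 1.
Proof.
move=> H; apply: (le_trans (nrm_prodB1 _ _ _)); rewrite lerD2r.
rewrite expR_sum big_seq_cond [leRHS]big_seq_cond.
apply: ler_prod => i /andP[si Pi].
have := nrm_factorB1 (e i) (H i si Pi).
by have := nrm_ge0 ((1 - x i) ^ e i - 1); lra.
Qed.

(** The error products below are all disposed of by this criterion: exponentials reduce them to sums
    of real numbers, whatever their length. *)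
Lemma tends_to_factors1 (I : eqType) (s : nat -> seq I) (P : nat -> pred I)
    (x : nat -> I -> R[i]) (e : nat -> I -> int) (v : nat -> R) :
  (forall M i, i \in s M -> P M i -> nrm (x M i) <= 2^-1) ->
  (forall M, \sum_(i <- s M | P M i) 2 * nrm (x M i) * (`|e M i|%N)%:R <= v M) ->
  v @ \oo --> (0 : R) ->
  tends_to (fun M => \prod_(i <- s M | P M i) (1 - x M i) ^ (e M i)) 1.
Proof.
move=> H1 H2 v0; apply: (@tends_to_squeeze _ _ _ (fun M => expR (v M) - 1)).
  apply: nearW => M; apply: (le_trans (nrm_factorsB1 _ (H1 M))).
  by rewrite lerD2r ler_expR.
rewrite -(subrr (1 : R)) -{2}(@expR0 R); apply: cvgB; last exact: cvg_cst.
by apply: (cvg_comp v expR v0); exact: continuous_expR.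
Qed.

Lemma cvg_geom_half (C : R) : (fun M : nat => C * 2^-1 ^+ M) @ \oo --> (0 : R).
Proof.
apply: (@cvg_geometric R C 2^-1).
by rewrite ger0_norm ?invr_ge0// invf_lt1// ltr1n.
Qed.

Lemma nat_le_exp2 (M : nat) : M%:R <= 2 ^+ M :> R.
Proof. by rewrite -natrX ler_nat ltnW// ltn_expl. Qed.

(** Origin of the 4 in the smallness conditions: half of the decay of 4^-M pays for a number of
    terms linear in M. *)
Lemma nat_quarter (M : nat) : M%:R * 4^-1 ^+ M <= 2^-1 ^+ M :> R.
Proof.
have -> : 4^-1 = 2^-1 * 2^-1 :> R by rewrite -invfM -natrM.
rewrite exprMn mulrA ler_piMl ?exprn_ge0 ?invr_ge0//.
by rewrite exprVn ler_pdivrMr ?exprn_gt0// mul1r nat_le_exp2.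
Qed.

Lemma bernoulli_ge (y : R) n : 0 <= y -> 1 + n%:R * y <= (1 + y) ^+ n.
Proof.
move=> y0; elim: n => [|n IH]; first by rewrite mul0r addr0 expr0.
rewrite exprSr; apply: (@le_trans _ _ ((1 + n%:R * y) * (1 + y))).
  rewrite -(natr1 n); have : 0 <= n%:R * y * y by rewrite !mulr_ge0.
  by move=> h; nra.
by rewrite ler_wpM2r// addr_ge0.
Qed.

(** The constant is normalised to 1: since n > 0, a bound |c n| <= C x^-n takes this form after [x]
    is shrunk. *)
Definition exp_bound (rho : R) (c : nat -> int) : Prop :=
  forall n, (0 < n)%N -> (`|c n|%N)%:R * rho ^+ n <= 1.

(* Consecutive partial products have quotient [(1 - x^n)^(c n)], which must
   therefore tend to 1. *)
Lemma product_exp_bound (c : nat -> int) (x : R) A l : 0 < x < 1 -> l != 0 ->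
  tends_to (fun M => A * \prod_(1 <= n < M.+1) (1 - x%:C ^+ n) ^ c n) l ->
  exists2 rho, 0 < rho <= 1 & exp_bound rho c.
Proof.
move=> /andP[x0 x1] l0 ul.
set u := (fun M => _) in ul.
have A0 : A != 0.
  apply: contraNneq l0 => A0; apply/eqP; apply: (tends_to_uniq ul).
  have -> : u = fun=> 0 by apply/funext => M; rewrite /u A0 mul0r.
  exact: tends_to_cst.
have xn n : (0 < n)%N -> 0 < x ^+ n < 1 by case: n => // n _; rewrite exprn_gt0//= exprn_ilt1// ltW.
have f0 n : (0 < n)%N -> 1 - x%:C ^+ n != 0.
  move=> n0; rewrite -[1](rmorph1 (real_complex R)) -rmorphXn -rmorphB.
  rewrite -nrm_gt0 nrmR normr_gt0; have /andP[] := xn n n0; lra.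
have u0 M : u M != 0.
  rewrite /u mulf_neq0// prodf_seq_neq0; apply/allP => n.
  by rewrite mem_index_iota => /andP[n0 _]; rewrite /= expfz_neq0// f0.
have ratio : tends_to (fun M => u M.+1 * (u M)^-1) 1.
  rewrite -(mulfV l0); apply: tends_toM; last exact: tends_toV.
  exact/tends_to_shift.
have ratioE M : u M.+1 * (u M)^-1 = (1 - x%:C ^+ M.+1) ^ c M.+1.
  by rewrite /u big_nat_recr//= mulrA mulrAC mulfV ?mul1r// u0.
have half : 0 < 2^-1 :> R by rewrite invr_gt0.
have := tends_to_le half ratio => -[N _ HN].
have big n : (N < n)%N -> (`|c n|%N)%:R * x ^+ n <= 1.
  case: n => // n Nn; have /= := HN n Nn; rewrite ratioE.
  set y := 1 - x ^+ n.+1; have /andP[xn0 xn1] := xn n.+1 isT.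
  have -> : 1 - x%:C ^+ n.+1 = y%:C by rewrite /y rmorphB rmorph1 rmorphXn.
  have y0 : 0 < y by rewrite /y; lra.
  move=> h; have h1 : 2^-1 <= nrm (y%:C ^ c n.+1) <= 2.
    have t1 := nrmD (y%:C ^ c n.+1 - 1) 1.
    have t2 := nrmD (y%:C ^ c n.+1) (1 - y%:C ^ c n.+1).
    rewrite addrC subrK in t2; rewrite subrK in t1.
    rewrite nrm1 in t1 t2; rewrite nrmB in h.
    rewrite (nrmB _ 1) in t1; lra.
  move: h1; rewrite nrmZ nrmR (ger0_norm (ltW y0)) exprz_absz => h1.
  have Vy : y^-1 ^+ `|c n.+1|%N <= 2.
    case: ifP h1 => _ /andP[h1 h2] //.
    by rewrite exprVn -(invrK 2) lef_pV2 ?posrE ?exprn_gt0.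
  (* With z = x^(n+1) one has 1 + z <= 1 / (1 - z) = 1 / y. The power of 1 / y with exponent |c| is
     at most 2, so Bernoulli's inequality gives |c| z <= 1. *)
  have := bernoulli_ge `|c n.+1|%N (ltW xn0).
  have : (1 + x ^+ n.+1) ^+ `|c n.+1|%N <= y^-1 ^+ `|c n.+1|%N.
    have Vy0 : 0 <= y^-1 by rewrite invr_ge0 ltW.
    apply: lerXn2r; rewrite ?nnegrE//; first by lra.
    by rewrite -[leRHS]div1r ler_pdivlMr// /y; nra.
  lra.
(* The finitely many remaining indices are absorbed by passing from [x] to x / B, because B <=
   B^n. *)
pose B : R := 1 + \sum_(n < N.+1) (`|c n|%N)%:R.
have S0 : 0 <= \sum_(n < N.+1) (`|c n|%N)%:R :> R by rewrite sumr_ge0.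
have B1 : 1 <= B by rewrite /B; lra.
exists (x / B).
  rewrite divr_gt0 ?(lt_le_trans _ B1)//= ler_pdivrMr ?(lt_le_trans _ B1)//; lra.
move=> n n0; rewrite exprMn exprVn mulrA ler_pdivrMr ?exprn_gt0 ?(lt_le_trans _ B1)// mul1r.
have Bn : B <= B ^+ n by rewrite -{1}[B]expr1 ler_weXn2l.
have [Nn|nN] := ltnP N n; first by apply: (le_trans (big n Nn)); apply: le_trans Bn.
apply: le_trans Bn; apply: (@le_trans _ _ (`|c n|%N)%:R).
  by rewrite ler_piMr//; have /andP[_ /ltW] := xn n n0.
have nN' : (n < N.+1)%N by [].
rewrite /B (bigD1 (Ordinal nN'))//= addrCA lerDl addr_ge0// sumr_ge0//.
Qed.

End ProductEstimates.

(** * Regrouping an infinite product *)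

Section Rearrangement.
Variable R : realType.
Implicit Types (X l : R[i]).

Definition channel_pow (a d n : nat) : nat := (n %/ gcdn n d * a)%N.

Lemma one_subX_neq0 X n : (0 < n)%N -> nrm X < 1 -> 1 - X ^+ n != 0.
Proof.
move=> n0 X1; rewrite subr_eq0; apply/eqP => E.
have : nrm (X ^+ n) < 1 by rewrite nrmX exprn_ilt1 ?nrm_ge0// -lt0n.
by rewrite -E nrm1 ltxx.
Qed.

Lemma channel_powP a d n m : (0 < d)%N ->
  (n * a == m * gcdn n d)%N = (channel_pow a d n == m).
Proof.
move=> d0; have g0 : (0 < gcdn n d)%N by rewrite gcdn_gt0 d0 orbT.
rewrite -{1}(divnK (dvdn_gcdl n d)) mulnAC eqn_pmul2r//.
Qed.

Lemma channel_pow_gt0 a d n : (0 < a)%N -> (0 < d)%N -> (0 < n)%N -> (0 < channel_pow a d n)%N.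
Proof.
move=> a0 d0 n0; rewrite muln_gt0 a0 andbT divn_gt0 ?gcdn_gt0 ?d0 ?orbT//.
by rewrite dvdn_leq// dvdn_gcdl.
Qed.

Lemma channel_pow_ge a d n : (0 < a)%N -> (0 < d)%N -> (n <= channel_pow a d n * d)%N.
Proof.
move=> a0 d0; rewrite -{1}(divnK (dvdn_gcdl n d)) /channel_pow -mulnA leq_mul//.
by rewrite (leq_trans (dvdn_leq d0 (dvdn_gcdr n d)))// leq_pmull.
Qed.

Lemma exprz_sum (K : fieldType) (y : K) (I : Type) (s : seq I) (P : pred I) (e : I -> int) :
  y != 0 -> y ^ (\sum_(i <- s | P i) e i) = \prod_(i <- s | P i) y ^ e i.
Proof.
move=> y0; elim/big_rec2: _ => [|i x a _ <-]; first by rewrite expr0z.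
by rewrite expfzDr.
Qed.

(** Since n <= d mu(n), the factors with mu(n) <= M all occur among n <= M d, and regrouped they
    form the M-th partial product of the conclusion. The other factors with n <= M d satisfy
    |X|^mu(n) <= rho^n 4^-M; the growth bound cancels rho^n, and their product [E M] tends to 1. *)
Lemma channel_rearrange (a d : nat) (c : nat -> int) (rho : R) X l :
  (0 < a)%N -> (0 < d)%N -> 0 < rho <= 1 -> exp_bound rho c ->
  nrm X <= rho ^+ d / 4 ->
  tends_to (fun M => \prod_(1 <= n < M.+1)
     (1 - X ^+ channel_pow a d n) ^ ((gcdn n d)%:Z * c n)) l ->
  tends_to (fun M => \prod_(1 <= m < M.+1) (1 - X ^+ m) ^ channel_exp a d c m) l.
Proof.
move=> a0 d0 /andP[rho0 rho1] bc XR ul.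
have rd1 : rho ^+ d <= 1 by rewrite exprn_ile1// ltW.
have X4 : nrm X <= 4^-1 by lra.
have X1 : nrm X < 1 by lra.
pose F n := (1 - X ^+ channel_pow a d n) ^ ((gcdn n d)%:Z * c n).
pose mu := channel_pow a d.
have F0 n : (0 < n)%N -> F n != 0.
  by move=> n0; rewrite expfz_neq0// one_subX_neq0// channel_pow_gt0.
have QE M : \prod_(1 <= m < M.+1) (1 - X ^+ m) ^ channel_exp a d c m =
    \prod_(1 <= n < (M * d).+1 | (mu n < M.+1)%N) F n.
  transitivity (\prod_(1 <= m < M.+1) \prod_(1 <= n < (M * d).+1 | mu n == m) F n).
    rewrite !big_nat; apply: eq_bigr => m /andP[m0 mM].
    rewrite /channel_exp exprz_sum ?one_subX_neq0//.
    have mMd : (m * d <= M * d)%N by rewrite leq_mul2r -ltnS mM orbT.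
    rewrite [RHS](@big_cat_nat _ _ _ (m * d).+1)//=.
    rewrite [X in _ = _ * X]big_nat_cond [X in _ = _ * X]big1 ?mulr1; last first.
      move=> n /andP[/andP[mn _] /eqP Em]; exfalso.
      by move: mn; rewrite ltnNge -Em channel_pow_ge.
    apply: eq_big => n; first by rewrite channel_powP.
    by rewrite channel_powP// => /eqP <-.
  under eq_bigr do rewrite big_mkcond.
  rewrite exchange_big /= [RHS]big_mkcond /= !big_nat; apply: eq_bigr => n /andP[n0 _].
  case: ifP => H.
    rewrite (bigD1_seq (mu n)) ?iota_uniq//=; last by rewrite mem_index_iota H channel_pow_gt0.
    rewrite eqxx big1 ?mulr1// => i ni; by rewrite eq_sym (negPf ni).
  rewrite big_nat big1// => i /andP[_ iM]; case: eqP => // E.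
  by move: H; rewrite E iM.
pose E M := \prod_(1 <= n < (M * d).+1 | ~~ (mu n < M.+1)%N) F n.
have TE M : \prod_(1 <= n < (M * d).+1) F n =
    (\prod_(1 <= m < M.+1) (1 - X ^+ m) ^ channel_exp a d c m) * E M.
  by rewrite QE (bigID (fun n => mu n < M.+1)%N).
have EN0 M : E M != 0.
  rewrite /E big_nat_cond prodf_seq_neq0; apply/allP => n _; apply/implyP.
  by move=> /andP[/andP[n0 _] _]; exact: F0.
have E1 : tends_to E 1.
  apply: (@tends_to_factors1 _ _ _ _ _ _ (fun M => (2 * d%:R * d%:R) * 2^-1 ^+ M)).
  - move=> M n; rewrite mem_index_iota => /andP[n0 _] _.
    rewrite nrmX; apply: (@le_trans _ _ (nrm X)); last by lra.
    have m0 := channel_pow_gt0 a0 d0 n0.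
    by rewrite -[leRHS]expr1; apply: ler_wiXn2l => //; rewrite ?nrm_ge0// ltW.
  - move=> M; apply: (@le_trans _ _ (\sum_(1 <= n < (M * d).+1) 2 * d%:R * 4^-1 ^+ M)).
      rewrite big_mkcond /= big_nat [leRHS]big_nat; apply: ler_sum => n /andP[n0 _].
      case: ifP => [|_]; last by rewrite !mulr_ge0 ?exprn_ge0 ?invr_ge0.
      rewrite -leqNgt => Mn.
      rewrite nrmX abszM absz_nat natrM.
      have XX : nrm X ^+ mu n <= rho ^+ n * 4^-1 ^+ M.
        apply: (@le_trans _ _ ((rho ^+ d / 4) ^+ mu n)).
          by apply: lerXn2r; rewrite ?nnegrE ?nrm_ge0// divr_ge0 ?exprn_ge0// ltW.
        rewrite exprMn -exprM; apply: ler_pM; rewrite ?exprn_ge0 ?invr_ge0 ?(ltW rho0)//.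
          by apply: ler_wiXn2l; rewrite ?(ltW rho0)// mulnC channel_pow_ge.
        by apply: ler_wiXn2l; rewrite ?invr_ge0 ?invf_le1 ?ler1n// ltnW.
      have gd : (gcdn n d)%:R <= d%:R :> R by rewrite ler_nat dvdn_leq// dvdn_gcdr.
      have bn := bc n n0.
      apply: (@le_trans _ _ (2 * (rho ^+ n * 4^-1 ^+ M) * (d%:R * `|c n|%:R))).
        apply: ler_pM; rewrite ?mulr_ge0 ?exprn_ge0 ?nrm_ge0//.
          by rewrite ler_pM2l.
        by rewrite ler_wpM2r.
      have -> : 2 * (rho ^+ n * 4^-1 ^+ M) * (d%:R * `|c n|%:R) =
         2 * d%:R * 4^-1 ^+ M * (`|c n|%:R * rho ^+ n) by ring.
      by rewrite ler_piMr// !mulr_ge0 ?exprn_ge0 ?invr_ge0.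
    rewrite sumr_const_nat subSS subn0 -[leLHS]mulr_natr natrM.
    have -> : 2 * d%:R * 4^-1 ^+ M * (M%:R * d%:R) =
        2 * d%:R * d%:R * (M%:R * 4^-1 ^+ M) :> R by ring.
    by apply: ler_wpM2l; [rewrite !mulr_ge0|exact: nat_quarter].
  - exact: cvg_geom_half.
have -> : (fun M => \prod_(1 <= m < M.+1) (1 - X ^+ m) ^ channel_exp a d c m) =
    (fun M => (\prod_(1 <= n < (M * d).+1) F n) * (E M)^-1).
  by apply/funext => M; rewrite TE mulfK.
rewrite -[l]mulr1; apply: tends_toM.
  exact: (tends_to_subseq ul (fun M => leq_pmulr M d0)).
by rewrite -[1]invr1; apply: tends_toV; rewrite ?oner_eq0.
Qed.

End Rearrangement.

(** * Power series, and their extraction from infinite products *)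

Section PowerSeries.
Variable R : realType.
Implicit Types (X l s : R[i]) (a : nat -> R[i]).

Lemma geom_half_le (M K : nat) :
  \sum_(M <= i < K) 2^-1 ^+ i <= 2 * 2^-1 ^+ M :> R.
Proof.
have [MK|KM] := leqP M K; last first.
  by rewrite big_geq ?(ltnW KM)// mulr_ge0 ?exprn_ge0 ?invr_ge0.
suff -> : \sum_(M <= i < K) 2^-1 ^+ i = 2 * 2^-1 ^+ M - 2 * 2^-1 ^+ K :> R.
  by rewrite gerBl mulr_ge0 ?exprn_ge0 ?invr_ge0.
rewrite -(subnKC MK); elim: (K - M)%N => [|k IH]; first by rewrite addn0 big_geq// subrr.
by rewrite addnS big_nat_recr ?leq_addr//= IH exprS; field.
Qed.

Lemma series_tail_le (u : nat -> R[i]) (B : R) (M K : nat) : 0 <= B ->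
  (forall n, (M <= n)%N -> nrm (u n) <= B * 2^-1 ^+ n) ->
  nrm (\sum_(M <= n < K) u n) <= 2 * B * 2^-1 ^+ M.
Proof.
move=> B0 H; apply: (le_trans (nrm_sum _ _ _)).
apply: (@le_trans _ _ (\sum_(M <= n < K) B * 2^-1 ^+ n)).
  by rewrite big_nat [leRHS]big_nat; apply: ler_sum => n /andP[Mn _]; exact: H.
rewrite -mulr_sumr -mulrA mulrCA; apply: ler_wpM2l => //; exact: geom_half_le.
Qed.

Lemma seriesE (u : nat -> R[i]) n : series u n = \sum_(0 <= k < n) u k.
Proof. by []. Qed.

Lemma series_bound a X s : tends_to (series (fun n => a n * X ^+ n)) s ->
  exists2 B : R, 0 < B & forall n, nrm (a n) * nrm X ^+ n <= B.
Proof.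
move=> H; have h1 : 0 < 1 :> R by [].
have := tends_to_le h1 H => -[N _ HN].
have big n : (N <= n)%N -> nrm (a n) * nrm X ^+ n <= 2.
  move=> Nn; have t1 := HN n Nn; have t2 := HN n.+1 (leqW Nn).
  rewrite -nrmX -nrmM.
  have -> : a n * X ^+ n = (series (fun n => a n * X ^+ n) n.+1 - s) +
      (s - series (fun n => a n * X ^+ n) n).
    by rewrite !seriesE big_nat_recr//=; ring.
  by apply: (le_trans (nrmD _ _)); rewrite [X in _ + X]nrmB; move: t1 t2 => /=; lra.
have S0 : 0 <= \sum_(n < N) nrm (a n) * nrm X ^+ n.
  by apply: sumr_ge0 => i _; rewrite mulr_ge0 ?exprn_ge0 ?nrm_ge0.
exists (2 + \sum_(n < N) nrm (a n) * nrm X ^+ n); first by lra.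
move=> n; have [/big|nN] := leqP N n; first by lra.
rewrite (bigD1 (Ordinal nN))//= addrCA lerDl addr_ge0// sumr_ge0// => i _.
by rewrite mulr_ge0 ?exprn_ge0 ?nrm_ge0.
Qed.

(** The bound at radius [t] makes the terms of positive degree at |X| <= t de geometric: they start
    with at most B de and have ratio at most 1/2. *)
Lemma series_lead a X s (t B de : R) : 0 < B -> 0 < t -> 0 <= de <= 2^-1 ->
  (forall n, nrm (a n) * t ^+ n <= B) -> nrm X <= t * de ->
  tends_to (series (fun n => a n * X ^+ n)) s ->
  nrm (s - a 0%N) <= 4 * B * de.
Proof.
move=> B0 t0 /andP[de0 de2] Ha Xt H.
apply/ler_addgt0Pl => e e0.
have [N _ HN] := tends_to_le e0 H.
have := HN N.+1 (leqnSn _) => /=; rewrite seriesE big_nat_recl//= expr0 mulr1 => h.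
have tail : nrm (\sum_(0 <= i < N) a i.+1 * X ^+ i.+1) <= 2 * (B * 2 * de) * 2^-1 ^+ 0.
  apply: series_tail_le; first by rewrite !mulr_ge0// ltW.
  move=> n _; rewrite nrmM nrmX.
  apply: (@le_trans _ _ (nrm (a n.+1) * (t * de) ^+ n.+1)).
    by rewrite ler_wpM2l ?nrm_ge0// lerXn2r ?nnegrE ?nrm_ge0// mulr_ge0// ltW.
  rewrite exprMn mulrA; apply: (@le_trans _ _ (B * de ^+ n.+1)).
    by rewrite ler_wpM2r ?exprn_ge0.
  rewrite -!mulrA ler_wpM2l ?(ltW B0)// exprS mulrCA ler_wpM2l//.
  apply: (@le_trans _ _ (2^-1 ^+ n)).
    by rewrite lerXn2r ?nnegrE ?invr_ge0.
  by rewrite ler_peMl ?exprn_ge0 ?invr_ge0 ?ler1n.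
rewrite expr0 mulr1 in tail.
have -> : s - a 0%N = (s - (a 0%N + \sum_(0 <= i < N) a i.+1 * X ^+ i.+1)) +
   \sum_(0 <= i < N) a i.+1 * X ^+ i.+1 by ring.
apply: (le_trans (nrmD _ _)); rewrite nrmB.
have -> : e + 4 * B * de = e + 2 * (B * 2 * de) by ring.
exact: lerD.
Qed.

End PowerSeries.

(* The integral power series is read off from the polynomials [trunc_prod c M],
   in which [(1 - X^m)^-1] is replaced by the geometric sum of length [M + 1]. *)
Section TruncatedProducts.
Variables (R : realType) (c : nat -> int).
Implicit Types (X l : R[i]).

Definition trunc_factor (m L : nat) (e : int) : {poly int} :=
  (if 0 <= e then 1 - 'X^m else \sum_(k < L) 'X^(m * k)) ^+ `|e|%N.

Definition trunc_prod (M : nat) : {poly int} :=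
  \prod_(1 <= m < M.+1) trunc_factor m M.+1 (c m).

Definition eq_coefs n (p r : {poly int}) := forall i, (i < n)%N -> p`_i = r`_i.

Lemma eq_coefsM n p r p' r' : eq_coefs n p p' -> eq_coefs n r r' ->
  eq_coefs n (p * r) (p' * r').
Proof.
move=> hp hr i ni; rewrite !coefM; apply: eq_bigr => j _; congr (_ * _).
  by apply: hp; apply: leq_ltn_trans ni; rewrite -ltnS.
by apply: hr; apply: leq_ltn_trans ni; exact: leq_subr.
Qed.

Lemma eq_coefsX n p p' k : eq_coefs n p p' -> eq_coefs n (p ^+ k) (p' ^+ k).
Proof.
by move=> H; elim: k => [|k IH]; [rewrite !expr0|rewrite !exprS; exact: eq_coefsM].
Qed.

Lemma eq_coefs_prod n (s : seq nat) (F G : nat -> {poly int}) :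
  (forall i, i \in s -> eq_coefs n (F i) (G i)) ->
  eq_coefs n (\prod_(i <- s) F i) (\prod_(i <- s) G i).
Proof.
elim: s => [|i s IH] H; first by rewrite !big_nil.
rewrite !big_cons; apply: eq_coefsM; first by apply: H; rewrite mem_head.
by apply: IH => j js; apply: H; rewrite inE js orbT.
Qed.

Lemma trunc_factorS n m L e : (n <= m * L)%N ->
  eq_coefs n (trunc_factor m L.+1 e) (trunc_factor m L e).
Proof.
move=> nmL; apply: eq_coefsX; case: ifP => _ // i ni.
rewrite big_ord_recr /= coefD coefXn (_ : (i == m * L)%N = false) ?addr0//.
by apply/eqP => E; move: ni; rewrite E ltnNge nmL.
Qed.

Lemma trunc_factor1 m L e : (0 < m)%N -> (0 < L)%N -> eq_coefs m (trunc_factor m L e) 1.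
Proof.
move=> m0; case: L => // L _; rewrite /trunc_factor -[X in eq_coefs _ _ X](expr1n _ `|e|%N).
apply: eq_coefsX; case: ifP => _ i im.
  by rewrite coefB coefXn (ltn_eqF im) subr0.
rewrite coef_sum big_ord_recl /= muln0 expr0 big1 ?addr0// => k _.
rewrite coefXn; case: eqP => // E; exfalso; move: im.
by rewrite E ltnNge /bump /= leq_pmulr.
Qed.

(** Lengthening the geometric sums adds terms of degree m (M + 1) or more, and the new factor is 1
    up to degree M. Hence each coefficient is eventually constant, which gives [prod_coef] its
    meaning. *)
Lemma trunc_prodS M : eq_coefs M.+1 (trunc_prod M.+1) (trunc_prod M).
Proof.
rewrite /trunc_prod [X in eq_coefs _ X _]big_nat_recr//= -[X in eq_coefs _ _ X]mulr1.
apply: eq_coefsM; last exact: trunc_factor1.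
apply: eq_coefs_prod => m; rewrite mem_index_iota => /andP[m0 _].
by apply: trunc_factorS; rewrite leq_pmull.
Qed.

Definition prod_coef (n : nat) : int := (trunc_prod n)`_n.

Lemma trunc_prod_coef M n : (n <= M)%N -> (trunc_prod M)`_n = prod_coef n.
Proof.
move=> nM; rewrite -(subnKC nM); elim: (M - n)%N => [|k IH]; first by rewrite addn0.
by rewrite addnS trunc_prodS ?IH// ltnS leq_addr.
Qed.

Lemma prod_coef0 : prod_coef 0 = 1.
Proof. by rewrite /prod_coef /trunc_prod big_geq// coef1. Qed.

(** Domination by a real polynomial is stable under products, so a coefficient of a long product is
    bounded through one evaluation at a positive point. *)
Definition majorant (p : {poly int}) (P : {poly R}) :=
  forall i, (`|p`_i|)%:~R <= P`_i.

Lemma majorantM p P r Q : majorant p P -> majorant r Q -> majorant (p * r) (P * Q).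
Proof.
move=> hp hr i; rewrite !coefM intr_norm rmorph_sum /=.
apply: (le_trans (ler_norm_sum _ _ _)); apply: ler_sum => j _.
by rewrite intrM normrM -!intr_norm ler_pM ?hp ?hr// ler0z.
Qed.

Lemma majorant1 : majorant 1 1.
Proof. by move=> i; rewrite !coef1; case: eqP. Qed.

Lemma majorantX p P k : majorant p P -> majorant (p ^+ k) (P ^+ k).
Proof.
move=> H; elim: k => [|k IH]; first exact: majorant1.
by rewrite !exprS; exact: majorantM.
Qed.

Lemma majorant_coef (p : {poly int}) P (t : R) i : 0 <= t -> majorant p P ->
  `|p`_i|%:~R * t ^+ i <= P.[t].
Proof.
move=> t0 H; have P0 j : 0 <= P`_j by apply: le_trans (H j); rewrite ler0z.
have [iP|Pi] := ltnP i (size P); last first.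
  have := H i; rewrite (nth_default 0 Pi) => h.
  apply: (@le_trans _ _ 0); first by rewrite mulr_le0_ge0 ?exprn_ge0.
  by rewrite horner_coef sumr_ge0// => j _; rewrite mulr_ge0 ?exprn_ge0.
rewrite horner_coef (bigD1 (Ordinal iP))//=; apply: ler_wpDr.
  by rewrite sumr_ge0// => j _; rewrite mulr_ge0 ?exprn_ge0.
by rewrite ler_wpM2r ?exprn_ge0.
Qed.

Lemma trunc_factor_majorant m L e (t : R) : (0 < m)%N -> 0 <= t <= 2^-1 ->
  exists2 P, majorant (trunc_factor m L e) P &
    0 <= P.[t] <= expR (2 * t ^+ m * (`|e|%N)%:R).
Proof.
move=> m0 /andP[t0 t2].
have tm2 : t ^+ m <= 2^-1.
  by apply: (le_trans _ t2); rewrite -[leRHS]expr1 ler_wiXn2l//; lra.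
have tm0 : 0 <= t ^+ m by rewrite exprn_ge0.
suff [P hP /andP[P0 P1]] : exists2 P,
    majorant (if 0 <= e then 1 - 'X^m else \sum_(k < L) 'X^(m * k)) P &
    0 <= P.[t] <= 1 + 2 * t ^+ m.
  exists (P ^+ `|e|%N); first exact: majorantX.
  rewrite horner_exp exprn_ge0//= mulrC expRM_natl lerXn2r ?nnegrE ?expR_ge0//.
  exact: le_trans P1 (expR_ge1Dx _).
case: ifP => _.
  exists (1 + 'X^m).
    move=> i; rewrite coefB coefD !coef1 !coefXn.
    by case: eqP; case: eqP => //= _ _;
      rewrite ?subr0 ?sub0r ?subrr ?normrN ?normr1 ?normr0 ?addr0 ?add0r//= -[1 + 1]/(2%:R : R).
  by rewrite hornerD hornerC hornerXn addr_ge0//=; lra.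
exists (\sum_(k < L) 'X^(m * k)).
  move=> i; rewrite !coef_sum intr_norm rmorph_sum /=.
  apply: (le_trans (ler_norm_sum _ _ _)); apply: ler_sum => j _.
  by rewrite !coefXn; case: eqP => _; rewrite ?normr1 ?normr0.
rewrite horner_sum; under eq_bigr do rewrite hornerXn exprM.
rewrite sumr_ge0 /=; last by move=> k _; rewrite exprn_ge0.
have := subrX1 (t ^+ m) L.
set S := \sum_(i < L) _ => E.
have TL : 0 <= (t ^+ m) ^+ L by rewrite exprn_ge0.
have S1 : (1 - t ^+ m) * S <= 1 by rewrite -[1 - t ^+ m]opprB mulNr -E; lra.
have S0 : 0 <= S by rewrite sumr_ge0// => k _; rewrite exprn_ge0.
nra.
Qed.

(** The point is uniformity in [M]: it controls the coefficients of degree above [M], which have not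
    yet stabilised. From |c m| (2 t)^m <= 1 the exponent is at most the sum of the 2 * 2^-m, hence
    below 4. *)
Lemma prod_coef_bound (t : R) : 0 <= t -> exp_bound (t * 2) c -> t <= 2^-1 ->
  forall M i, (`|(trunc_prod M)`_i|)%:~R * t ^+ i <= expR 4.
Proof.
move=> t0 bc t2 M i.
suff [P hP PT] : exists2 P, majorant (trunc_prod M) P &
    0 <= P.[t] <= expR (\sum_(1 <= m < M.+1) 2 * t ^+ m * (`|c m|%N)%:R).
  move/andP: PT => [_ PT]; apply: (le_trans (majorant_coef i t0 hP)); apply: (le_trans PT).
  rewrite ler_expR; apply: (@le_trans _ _ (\sum_(1 <= m < M.+1) 2 * 2^-1 ^+ m)).
    rewrite big_nat [leRHS]big_nat; apply: ler_sum => m /andP[m0 _].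
    rewrite -mulrA ler_wpM2l//; have := bc m m0; rewrite exprMn => h.
    by rewrite exprVn -[leRHS]div1r ler_pdivlMr ?exprn_gt0//; lra.
  rewrite -mulr_sumr; have := geom_half_le R 1 M.+1; rewrite expr1; lra.
rewrite /trunc_prod; move: (index_iota 1 M.+1) (mem_index_iota 1 M.+1) => s hs.
have {hs} : forall m, m \in s -> (0 < m)%N by move=> m; rewrite hs => /andP[].
elim: s => [|m s IH] hs.
  by exists 1; rewrite !big_nil ?hornerC ?expR0 ?ler01 ?lexx//; exact: majorant1.
have [|P hP /andP[P0 P1]] := IH; first by move=> k ks; apply: hs; rewrite inE ks orbT.
have tt : 0 <= t <= 2^-1 by rewrite t0.
have [Q hQ /andP[Q0 Q1]] := trunc_factor_majorant M.+1 (c m) (hs m (mem_head _ _)) tt.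
exists (Q * P); first by rewrite big_cons; exact: majorantM.
by rewrite big_cons hornerM expRD mulr_ge0//= ler_pM.
Qed.

Definition evalC (p : {poly int}) X : R[i] := (map_poly intr p).[X].

(** The second product collects the numerators of 1 + Y + ... + Y^M = (1 - Y^(M+1)) / (1 - Y), for Y
    = X^m with a negative exponent. *)
Lemma trunc_prod_eval M X : nrm X < 1 ->
  evalC (trunc_prod M) X = (\prod_(1 <= m < M.+1) (1 - X ^+ m) ^ c m) *
    \prod_(1 <= m < M.+1) (1 - X ^+ (m * M.+1)) ^ (if 0 <= c m then 0 else `|c m|).
Proof.
move=> X1; rewrite /evalC /trunc_prod rmorph_prod horner_prod -big_split /=.
rewrite !big_nat; apply: eq_bigr => m /andP[m0 _].
rewrite /trunc_factor rmorphXn horner_exp /= exprz_absz.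
case: ifP => _.
  by rewrite expr0z mulr1 rmorphB rmorph1 /= map_polyXn hornerD hornerN hornerC hornerXn.
have -> : `|c m| = (`|c m|%N)%:Z :> int by rewrite abszE.
rewrite -exprnP -exprMn; congr (_ ^+ _).
rewrite rmorph_sum horner_sum /=; under eq_bigr do rewrite map_polyXn hornerXn exprM.
rewrite exprM; have := subrX1 (X ^+ m) M.+1 => E.
apply: (mulfI (one_subX_neq0 m0 X1)); rewrite mulrA mulfV ?one_subX_neq0// mul1r.
by rewrite -[1 - X ^+ m]opprB mulNr -E opprB.
Qed.

(** The truncated products, evaluated at [X], tend to [l] because the numerators tend to 1. They
    agree with the partial sums of the series up to degree M, and the uniform coefficient bound
    makes the rest O(2^-M). *)
Lemma product_to_series (rho : R) X l : 0 < rho <= 1 -> exp_bound rho c ->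
  nrm X <= rho / 4 ->
  tends_to (fun M => \prod_(1 <= m < M.+1) (1 - X ^+ m) ^ c m) l ->
  tends_to (series (fun n => (prod_coef n)%:~R * X ^+ n)) l.
Proof.
move=> /andP[rho0 rho1] bc X4 ul.
have X4' : nrm X <= 4^-1 by lra.
have X1 : nrm X < 1 by lra.
have Xge0 := nrm_ge0 X.
have corr : tends_to (fun M => \prod_(1 <= m < M.+1)
    (1 - X ^+ (m * M.+1)) ^ (if 0 <= c m then 0 else `|c m|)) 1.
  apply: (@tends_to_factors1 _ _ _ _ (fun M m => X ^+ (m * M.+1))
     (fun M m => if 0 <= c m then 0 else `|c m|) (fun M => 2 * 2^-1 ^+ M)).
  - move=> M m; rewrite mem_index_iota => /andP[m0 _] _; rewrite nrmX.
    apply: (@le_trans _ _ (nrm X)); last by lra.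
    by rewrite -[leRHS]expr1 ler_wiXn2l ?muln_gt0 ?m0//; lra.
  - move=> M; apply: (@le_trans _ _ (\sum_(1 <= m < M.+1) 2 * 4^-1 ^+ M)).
      rewrite big_nat [leRHS]big_nat; apply: ler_sum => m /andP[m0 _].
      rewrite nrmX -mulrA ler_wpM2l//.
      apply: (@le_trans _ _ ((rho ^+ m * 4^-1 ^+ M) * `|c m|%:R)).
        apply: ler_pM; rewrite ?exprn_ge0//.
          rewrite mulnS exprD ler_pM ?exprn_ge0//.
            by rewrite lerXn2r ?nnegrE ?(ltW rho0)//; lra.
          apply: (@le_trans _ _ (nrm X ^+ M)).
            by rewrite ler_wiXn2l ?leq_pmull//; lra.
          by rewrite lerXn2r ?nnegrE ?invr_ge0.
        by case: ifP => _; rewrite ?absz0 ?ler0n// abszE absz_nat.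
      have := bc m m0 => h; rewrite mulrAC ler_piMl ?exprn_ge0 ?invr_ge0//; lra.
    rewrite sumr_const_nat subSS subn0 -[leLHS]mulr_natr -mulrA ler_wpM2l//.
    by rewrite mulrC nat_quarter.
  - exact: cvg_geom_half.
have ev : tends_to (fun M => evalC (trunc_prod M) X) l.
  rewrite -[l]mulr1; apply: (tends_to_eq _ (tends_toM ul corr)) => M.
  by rewrite trunc_prod_eval.
apply/tends_to_shift.
(* The coefficient bound asks for the growth bound at 2 t = rho, and |X| <= t / 2 leaves a tail of
   ratio 1/2. *)
pose t := rho / 2.
have t0 : 0 < t by rewrite /t; lra.
have bt : exp_bound (t * 2) c by rewrite /t divfK.
have t12 : t <= 2^-1 by rewrite /t; lra.
have cb := prod_coef_bound (ltW t0) bt t12.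
have diff M : nrm (evalC (trunc_prod M) X -
    series (fun n => (prod_coef n)%:~R * X ^+ n) M.+1) <= 2 * expR 4 * 2^-1 ^+ M.
  rewrite seriesE /evalC.
  set p := trunc_prod M.
  have -> : (map_poly intr p).[X] = \sum_(0 <= i < maxn (size p) M.+1) (p`_i)%:~R * X ^+ i.
    rewrite (@horner_coef_wide _ (maxn (size p) M.+1)).
      by rewrite big_mkord; apply: eq_bigr => i _; rewrite coef_map.
    by rewrite (leq_trans (size_poly _ _))// leq_maxl.
  rewrite (@big_cat_nat _ _ _ M.+1)//=; last by rewrite leq_maxr.
  have -> : \sum_(0 <= i < M.+1) (p`_i)%:~R * X ^+ i = \sum_(0 <= n < M.+1) (prod_coef n)%:~R * X ^+ n.
    by rewrite !big_nat; apply: eq_bigr => i /andP[_ iM]; rewrite /p trunc_prod_coef.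
  rewrite addrAC subrr add0r.
  apply: (@le_trans _ _ (2 * expR 4 * 2^-1 ^+ M.+1)); last first.
    by rewrite ler_wpM2l ?mulr_ge0 ?expR_ge0// ler_wiXn2l ?invr_ge0 ?invf_le1 ?ler1n.
  apply: series_tail_le; first exact: expR_ge0.
  move=> n _; rewrite nrmM nrmX nrm_intr.
  have := cb M n; rewrite -/p => h.
  apply: (@le_trans _ _ ((`|p`_n|)%:~R * (t * 2^-1) ^+ n)).
    rewrite ler_wpM2l ?ler0z// lerXn2r ?nnegrE//; first by rewrite /t; lra.
    by rewrite /t; lra.
  by rewrite exprMn mulrA ler_wpM2r ?exprn_ge0 ?invr_ge0.
rewrite (_ : l = l - 0); last by rewrite subr0.
have zero : tends_to (fun M => - (evalC (trunc_prod M) X -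
    series (fun n => (prod_coef n)%:~R * X ^+ n) M.+1)) 0.
  apply: (@tends_to_squeeze _ _ _ (fun M => 2 * expR 4 * 2^-1 ^+ M)).
    by apply: nearW => M; rewrite subr0 nrmN.
  exact: cvg_geom_half.
rewrite subr0 -[l]addr0; apply: (tends_to_eq _ (tends_toD ev zero)) => M.
by rewrite opprB addrC subrK.
Qed.

End TruncatedProducts.

(** * Products over roots of unity *)

Section RootsOfUnity.

Lemma prod_periodic (K : comPzRingType) (F : nat -> K) (m g : nat) :
  (forall b, F (b + m)%N = F b) ->
  \prod_(0 <= b < m * g) F b = (\prod_(0 <= b < m) F b) ^+ g.
Proof.
move=> per; have perg k b : F (b + m * k)%N = F b.
  by elim: k => [|k IH]; rewrite ?muln0 ?addn0// mulnS addnCA addnC per.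
elim: g => [|g IH]; first by rewrite muln0 big_geq.
rewrite mulnS addnC (@big_cat_nat _ _ _ (m * g)%N) ?leq_addr//= IH exprSr; congr (_ * _).
rewrite -{1}[(m * g)%N]add0n big_addn addKn; apply: eq_bigr => b _; exact: perg.
Qed.

(** The factorization of X^m - 1 over the powers of [w], evaluated at 1 / y and multiplied by
    y^m. *)
Lemma prod_primitive_root (K : fieldType) (w y : K) m : m.-primitive_root w ->
  \prod_(0 <= b < m) (1 - w ^+ b * y) = 1 - y ^+ m.
Proof.
move=> prim; have m0 := prim_order_gt0 prim.
have [->|y0] := eqVneq y 0.
  by rewrite expr0n -[m == 0%N]negbK -lt0n m0 subr0 big1// => b _; rewrite mulr0 subr0.
have := congr1 (fun p => p.[y^-1]) (factor_Xn_sub_1 prim).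
rewrite hornerD hornerN hornerC hornerXn horner_prod => E.
transitivity (y ^+ m * (y^-1 ^+ m - 1)); last first.
  by rewrite mulrBr -exprMn mulfV// expr1n mulr1.
rewrite -E big_mkord [X in _ = _ * X]big_mkord -[in y ^+ m](card_ord m) -prodr_const -big_split.
by apply: eq_bigr => b _ /=; rewrite hornerD hornerN hornerC hornerX mulrBr mulfV// mulrC.
Qed.

(** z^n is primitive of order d / gcd(n, d), so [b] runs through gcd(n, d) full periods. *)
Lemma prod_root_of_unity (K : fieldType) (z y : K) d n : d.-primitive_root z ->
  \prod_(0 <= b < d) (1 - z ^+ (n * b) * y) =
  (1 - y ^+ (d %/ gcdn n d)) ^+ gcdn n d.
Proof.
move=> prim; have primn := exp_prim_root prim n.
rewrite -(prod_primitive_root y primn) -prod_periodic.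
  rewrite divnK ?dvdn_gcdr//; apply: eq_bigr => b _.
  by rewrite exprM.
by move=> b; rewrite exprD (prim_expr_order primn) mulr1.
Qed.

Variable R : realType.

Definition unity_root (d : nat) : R[i] := qpow 1 (d%:R^-1)%:C.

Lemma unity_rootX d k : unity_root d ^+ k = qpow 1 (k%:R / d%:R)%:C.
Proof. by rewrite /unity_root qpowX mulrC qpowRM. Qed.

(** If the order m were smaller than d, the half angle th = pi m / d would lie strictly between 0
    and pi; but e(m / d) = 1 gives cos (2 th) = 1, so sin th = 0. *)
Lemma unity_root_prim d : (0 < d)%N -> d.-primitive_root (unity_root d).
Proof.
move=> d0; have dR : d%:R != 0 :> R by rewrite pnatr_eq0 -lt0n.
have zd : unity_root d ^+ d = 1 by rewrite unity_rootX mulfV// (qpow_nat R 1).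
have [m prim md] := prim_order_exists d0 zd.
have m0 := prim_order_gt0 prim.
have [E|mnd] := eqVneq m d; first by rewrite -{1}E.
have mltd : (m < d)%N by rewrite ltn_neqAle mnd dvdn_leq.
have := prim_expr_order prim; rewrite unity_rootX.
set th : R := pi * (m%:R / d%:R).
have th0 : 0 < th < pi.
  by rewrite mulr_gt0 ?pi_gt0 ?divr_gt0 ?ltr0n//= gtr_pMr ?pi_gt0// ltr_pdivrMr ?ltr0n// mul1r ltr_nat.
have -> : qpow 1 (m%:R / d%:R)%:C = expC (0 +i* (th + th)).
  rewrite /qpow; congr expC; rewrite /th.
  by apply/eqP; rewrite eq_complex /=; apply/andP; split; apply/eqP; ring.
rewrite /expC /= expR0 => /(congr1 (@complex.Re R)) /=.
rewrite cosD mul1r mul0r subr0 => E.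
have := sin_gt0_pi th0; have := cos2Dsin2 th; rewrite !expr2.
nra.
Qed.

End RootsOfUnity.

(** * Leading terms and uniqueness of the normalisation *)

Section LeadingTerm.
Variable R : realType.
Implicit Types (f : R[i] -> R[i]) (tau : R[i]).

Lemma exists_Im_gt (Y : R) : exists tau : R[i], Y < complex.Im tau.
Proof. by exists (0 +i* (Y + 1)); rewrite /= ltrDl. Qed.

Lemma q_neq0 tau : q tau != 0.
Proof. exact: qpow_neq0. Qed.

Lemma q_expansion_series f (m : int) (a : nat -> R[i]) tau :
  tends_to (series (fun n => a n * q tau ^ (m + n%:Z))) (f tau) <->
  tends_to (series (fun n => a n * q tau ^+ n)) (q tau ^ (- m) * f tau).
Proof.
have E s : series (fun n => a n * q tau ^ (m + n%:Z)) s =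
    q tau ^ m * series (fun n => a n * q tau ^+ n) s.
  rewrite !seriesE mulr_sumr; apply: eq_bigr => n _.
  by rewrite expfzDr ?q_neq0// -exprnP mulrCA.
have qm : q tau ^ (- m) * q tau ^ m = 1 by rewrite -expfzDr ?q_neq0// addNr expr0z.
split=> H.
  have H2 := @tends_toMl _ (q tau ^ (- m)) _ _ H.
  apply: (tends_to_eq _ H2) => s.
  by rewrite E mulrA qm mul1r.
have -> : f tau = q tau ^ m * (q tau ^ (- m) * f tau) by rewrite mulrA [X in X * _]mulrC qm mul1r.
by apply: (tends_to_eq _ (@tends_toMl _ (q tau ^ m) _ _ H)) => s; rewrite E.
Qed.

Lemma near_q_small (e : R) : 0 < e -> near_ioo (fun tau => nrm (q tau) < e).
Proof. by move=> e0; exact: near_ioo_small. Qed.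

(** One point of convergence supplies the coefficient bound; higher up, |q| is small relative to its
    value there, and the terms of positive degree are negligible. *)
Lemma q_expansion_lead f m (a : nat -> R[i]) (e : R) : 0 < e -> has_q_expansion f m a ->
  near_ioo (fun tau => nrm (q tau ^ (- m) * f tau - a 0%N) <= e).
Proof.
move=> e0 [Y H]; have [t0 Yt0] := exists_Im_gt Y.
have [B B0 HB] := series_bound (proj1 (q_expansion_series _ _ _ _) (H t0 Yt0)).
have t00 : 0 < nrm (q t0) by rewrite nrm_gt0 q_neq0.
pose de := Num.min 2^-1 (e / (4 * B)).
have de0 : 0 < de by rewrite /de lt_min invr_gt0 ltr0n divr_gt0// mulr_gt0.
have de2 : de <= 2^-1 by rewrite /de ge_min lexx.
have deB : 4 * B * de <= e.
  by rewrite mulrC -ler_pdivlMr ?mulr_gt0// /de ge_min lexx orbT.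
have := near_ioo_and (near_ioo_gt Y) (near_q_small (mulr_gt0 t00 de0)).
apply: near_iooW => tau [Yt qt]; apply: le_trans deB.
apply: (series_lead B0 t00 _ HB (ltW qt) (proj1 (q_expansion_series _ _ _ _) (H tau Yt))).
by rewrite (ltW de0).
Qed.

Lemma q_expansion_neq0 f m (a : nat -> R[i]) : a 0%N = 1 -> has_q_expansion f m a ->
  near_ioo (fun tau => f tau != 0).
Proof.
move=> a0 H; have h : 0 < 2^-1 :> R by rewrite invr_gt0.
apply: near_iooW (q_expansion_lead h H) => tau; rewrite a0; apply: contraTneq => ->.
by rewrite mulr0 sub0r nrmN nrm1 -ltNge invf_lt1// ltr1n.
Qed.

Lemma near_iooE (P : R[i] -> Prop) : near_ioo P ->
  exists2 Y : R, 0 < Y & forall t, Y < t -> P (0 +i* t).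
Proof.
move=> [Y H]; exists (Num.max Y 1); first by rewrite lt_max ltr01 orbT.
by move=> t; rewrite gt_max => /andP[Yt _]; exact: H.
Qed.

Lemma q_it (t : R) : nrm (q (0 +i* t)) = expR (- (2 * pi * t)).
Proof. by rewrite nrm_qpow mulr1. Qed.

(** Makes the choice inside [normalize] harmless. The quotient of the two leading terms is e q^(m -
    m'), and its absolute value lies in [1/4, 4] at both it and 2it for large t, which excludes m <>
    m'. Then [e] is 1 up to any given accuracy. *)
Lemma normalization_uniq f m m' (a a' : nat -> R[i]) (e : R[i]) :
  a 0%N = 1 -> a' 0%N = 1 -> has_q_expansion f m a ->
  has_q_expansion (fun tau => e * f tau) m' a' -> e = 1.
Proof.
move=> a0 a'0 H H'.
have key (d : R) : 0 < d -> exists2 Y : R, 0 < Y & forall t, Y < t ->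
    nrm (q (0 +i* t) ^ (- m) * f (0 +i* t) - 1) <= d /\
    nrm (e * (q (0 +i* t) ^ (m - m') * (q (0 +i* t) ^ (- m) * f (0 +i* t))) - 1) <= d.
  move=> d0; have := near_ioo_and (q_expansion_lead d0 H) (q_expansion_lead d0 H').
  move=> /near_iooE[Y Y0 HY]; exists Y => // t Yt.
  have [h1 h2] := HY t Yt; rewrite a0 in h1; rewrite a'0 in h2; split=> //.
  rewrite [q _ ^ (m - m') * _]mulrA -expfzDr ?q_neq0// addrAC subrr sub0r mulrCA.
  exact: h2.
have jm : m = m'.
  apply/eqP; rewrite -subr_eq0; apply/negP => /negP j0.
  have h2 : 0 < 2^-1 :> R by rewrite invr_gt0.
  have [Y Y0 HY] := key _ h2.
  (* Any value below 1/16 would serve: the two estimates confine X = |q|^(m - m') to [1/16, 16]. *)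
  have e10 : 0 < 100^-1 :> R by rewrite invr_gt0.
  have [Z Z0 HZ] := near_iooE (near_q_small e10).
  pose t := Y + Z.
  have Yt : Y < t by rewrite /t; lra.
  have Zt : Z < t by rewrite /t; lra.
  have Y2t : Y < t + t by rewrite /t; lra.
  have x10 := HZ t Zt.
  have [s1 s2] := HY t Yt; have [s3 s4] := HY _ Y2t.
  have bnd (w : R[i]) : nrm (w - 1) <= 2^-1 -> 2^-1 <= nrm w <= 2.
    move=> h; have t1 := nrmD (w - 1) 1; have t2 := nrmD w (1 - w).
    rewrite addrC subrK nrm1 (nrmB 1) in t2; rewrite subrK nrm1 in t1; lra.
  have nrm2 (x y : R[i]) k : nrm (x ^ k * y) = nrm x ^ k * nrm y by rewrite nrmM nrmZ.
  have nrm4 (x y : R[i]) j k : nrm (e * (x ^ j * (x ^ k * y))) =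
      nrm e * (nrm x ^ j * (nrm x ^ k * nrm y)) by rewrite !nrmM !nrmZ.
  have := bnd _ s1; have := bnd _ s2; have := bnd _ s3; have := bnd _ s4.
  rewrite !nrm4 !nrm2.
  set S1 := nrm (q (0 +i* t)) ^ (- m) * nrm (f (0 +i* t)).
  set S2 := nrm (q (0 +i* (t + t))) ^ (- m) * nrm (f (0 +i* (t + t))).
  set x := nrm (q (0 +i* t)) in x10 *.
  have -> : nrm (q (0 +i* (t + t))) = x * x.
    by rewrite /x !q_it -expRD; congr expR; ring.
  have x0 : 0 < x by rewrite /x q_it expR_gt0.
  rewrite expfzMl; set X := x ^ (m - m').
  have X0 : 0 < X by rewrite exprz_gt0.
  have XX : X <= 100^-1 \/ 100 <= X.
    have big n : x ^+ n.+1 <= 100^-1.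
      apply: le_trans (ltW x10); rewrite -[leRHS]expr1 ler_wiXn2l ?(ltW x0)//; lra.
    rewrite /X; case: (m - m') j0 => [[//|n]|n] _; first by left; exact: big.
    right; rewrite NegzE -exprnN -[leLHS]invrK lef_pV2 ?posrE ?exprn_gt0//.
  move=> /andP[u1 v1] /andP[u2 v2] /andP[u3 v3] /andP[u4 v4].
  have E0 := nrm_ge0 e.
  have A0 : nrm e * X <= 4.
    have : nrm e * X * S1 <= 2 by rewrite -mulrA.
    have : 0 <= nrm e * X by rewrite mulr_ge0// ltW.
    nra.
  have A1 : 4^-1 <= nrm e * X.
    have : 2^-1 <= nrm e * X * S1 by rewrite -mulrA.
    have : 0 <= nrm e * X by rewrite mulr_ge0// ltW.
    nra.
  have B0 : nrm e * X * X <= 4.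
    have : nrm e * X * X * S2 <= 2 by rewrite -2!mulrA [X * (X * _)]mulrA.
    have : 0 <= nrm e * X * X by rewrite !mulr_ge0// ltW.
    nra.
  have B1 : 4^-1 <= nrm e * X * X.
    have : 2^-1 <= nrm e * X * X * S2 by rewrite -2!mulrA [X * (X * _)]mulrA.
    have : 0 <= nrm e * X * X by rewrite !mulr_ge0// ltW.
    nra.
  move: A0 A1 B0 B1; set W := nrm e * X => A0 A1 B0 B1.
  by suff: 0 < 0 :> R by [rewrite ltxx]; case: XX => ?; nra.
subst m'.
apply/eqP; rewrite -subr_eq0 -nrm_eq0; apply/eqP/le_anti; rewrite nrm_ge0 andbT.
apply/ler_addgt0Pl => d d0; rewrite addr0.
have E0 := nrm_ge0 e.
(* The splitting e - 1 = e (1 - S) + (e S - 1) costs a factor |e| + 1 in accuracy. *)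
have d1 : 0 < d / (nrm e + 1) by rewrite divr_gt0// ltr_pwDr.
have [Y Y0 HY] := key _ d1.
have Y1 : Y < Y + 1 by rewrite ltrDl.
have [h1 h2] := HY (Y + 1) Y1.
move: h1 h2; rewrite subrr expr0z mul1r; set S := _ * f _ => h1 h2.
have -> : e - 1 = e * (1 - S) + (e * S - 1) by ring.
apply: (le_trans (nrmD _ _)); rewrite nrmM.
apply: (@le_trans _ _ (nrm e * (d / (nrm e + 1)) + d / (nrm e + 1))).
  by rewrite lerD// ler_wpM2l// nrmB.
rewrite -[X in _ + X]mul1r -mulrDl mulrCA mulfV ?mulr1//.
by rewrite gt_eqF// ltr_pwDr.
Qed.

End LeadingTerm.

Lemma iota_index d : iota 0 d = index_iota 0 d.
Proof. by rewrite /index_iota subn0. Qed.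

(** * The Hecke image at i oo *)

Section HeckeExpansion.
Variable R : realType.
Implicit Types (f : R[i] -> R[i]) (tau : R[i]).

Definition hecke_point (n : nat) (x : nat * nat) tau : R[i] :=
  ((n %/ x.1)%:R / x.1%:R : R)%:C * tau + (x.2%:R / x.1%:R : R)%:C.

Definition hecke_prod f (n : nat) (s : seq (nat * nat)) tau : R[i] :=
  \prod_(x <- s) f (hecke_point n x tau).

Lemma slash_upper (k : int) (n d b : nat) f tau : (0 < n)%N -> (d %| n)%N ->
  slash k (mx2 (n %/ d)%:R b%:R 0 d%:R) f tau =
  ((n%:R : R) `^ (k%:~R / 2))%:C * d%:R ^ (- k) * f (hecke_point n (d, b) tau).
Proof.
move=> n0 dn; have d0 : (0 < d)%N by exact: dvdn_gt0 dn.
have dR : (d%:R : R[i]) != 0 by rewrite pnatr_eq0 -lt0n.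
rewrite /slash det2E /moebius /cocycle !mx2E mulr0 subr0 -natrM divnK//.
have -> : ((0 : R)%:C * tau + (d%:R)%:C) = d%:R :> R[i] by rewrite rmorph_nat mul0r add0r.
congr (_ * _ * f _); rewrite /hecke_point /= !rmorphM !fmorphV !rmorph_nat /= mulrDl.
by rewrite mulrAC.
Qed.

(** The determinant, the automorphy factor d^-k and the explicit power of p do not depend on tau, so
    they join the constant that [normalize] adjusts. *)
Lemma heckeE (N p r : nat) (k : int) f : prime p ->
  exists2 C : R[i], C != 0 & hecke N p r k f =
    normalize (fun tau => C * hecke_prod f (p ^ r) (hecke_reps N p r) tau).
Proof.
move=> pp; have n0 : (0 < p ^ r)%N by rewrite expn_gt0 prime_gt0.
have pR : 0 < (p%:R : R) by rewrite ltr0n prime_gt0.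
set n := (p ^ r)%N in n0 *.
pose w (x : nat * nat) : R[i] := ((n%:R : R) `^ (k%:~R / 2))%:C * x.1%:R ^ (- k).
have rC (x : R) : 0 < x -> x%:C != 0 by move=> x0; rewrite -nrm_gt0 nrmR normr_gt0 gt_eqF.
have w0 : \prod_(x <- hecke_reps N p r) w x != 0.
  rewrite big_seq_cond prodf_seq_neq0; apply/allP => x _; apply/implyP => /andP[xr _].
  have [xn xb] := hecke_reps_dvd pp xr.
  rewrite mulf_neq0// ?expfz_neq0 ?pnatr_eq0 -?lt0n ?(dvdn_gt0 n0)//.
  by apply: rC; apply: powR_gt0; rewrite ltr0n.
have E : \prod_(x <- hecke_reps N p r) slash k (mx2 (n %/ x.1)%:R x.2%:R 0 x.1%:R) f =1
    fun tau => (\prod_(x <- hecke_reps N p r) w x) * hecke_prod f n (hecke_reps N p r) tau.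
  move=> tau; rewrite fct_prodE /hecke_prod -big_split big_seq [RHS]big_seq /=.
  apply: eq_bigr => x xr; have [xn xb] := hecke_reps_dvd pp xr.
  by rewrite slash_upper// /w; case: x {xr xn xb}.
rewrite /hecke; case: ifPn => pN.
  exists (((p%:R : R) `^ (r%:R * k%:~R * p%:R ^+ r / 2))%:C * \prod_(x <- hecke_reps N p r) w x).
    by rewrite mulf_neq0//; apply: rC; exact: powR_gt0.
  congr normalize; apply/funext => tau; rewrite -[RHS]mulrA -E fct_prodE; congr (_ * _).
  rewrite /hecke_reps /hecke_dens pN big_allpairs_dep big_seq1 /=.
  rewrite iota_index big_mkord; apply: eq_bigr => j _.
  by rewrite divnn n0.
eexists (_ * \prod_(x <- hecke_reps N p r) w x); last first.
  congr normalize; apply/funext => tau; rewrite -[RHS]mulrA -E fct_prodE; congr (_ * _).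
  rewrite /hecke_reps /hecke_dens (negPf pN) big_allpairs_dep /=.
  apply: eq_bigr => d _.
  by rewrite iota_index big_mkord.
by rewrite mulf_neq0//; apply: rC; exact: powR_gt0.
Qed.

(** One admissible factor [e] shows that the choice has a solution; uniqueness, applied to the
    quotient of the chosen factor by [e], identifies the two. *)
Lemma normalizeE f (m : int) (a : nat -> R[i]) (e : R[i]) : a 0%N = 1 ->
  has_q_expansion (fun tau => e * f tau) m a -> normalize f = fun tau => e * f tau.
Proof.
move=> a0 H; rewrite /normalize.
have h : [set e : R[i] | leading_coef (fun tau => e * f tau) 1] e.
  by split; [exact: oner_neq0|exists m, a].
set e' := xget 0 _.
have : leading_coef (fun tau => e' * f tau) 1.
  exact: (xgetPex 0 (ex_intro _ e h)).
move=> [_ [m' [a' [a'0 H']]]].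
have [Y fY] := near_ioo_and (q_expansion_neq0 a0 H) (q_expansion_neq0 a'0 H').
have [tau Yt] := exists_Im_gt Y; have [f1 f2] := fY tau Yt.
have e0 : e != 0 by apply: contraNneq f1 => ->; rewrite mul0r.
have : e' / e = 1.
  have E3 : (fun tau => (e' / e) * (e * f tau)) = (fun tau => e' * f tau).
    by apply/funext => t; rewrite mulrA divfK.
  have H2 : has_q_expansion (fun tau => (e' / e) * (e * f tau)) m' a' by rewrite E3.
  exact: (@normalization_uniq R (fun tau => e * f tau) m m' a a' (e' / e) a0 a'0 H H2).
by move=> /(canRL (divfK e0)); rewrite mul1r => ->.
Qed.

(** On the imaginary axis q is a real number in (0, 1), as the growth estimate requires. *)
Lemma product_expansion_bound f (h : int) (c : nat -> int) :
  near_ioo (fun tau => f tau != 0) -> has_product_expansion f h c ->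
  exists2 rho : R, 0 < rho <= 1 & exp_bound rho c.
Proof.
move=> f0 H; have /near_iooE[Y Y0 HY] := near_ioo_and f0 H.
have Y1 : Y < Y + 1 by rewrite ltrDl.
have [l0 ul] := HY _ Y1.
have qE : q (0 +i* (Y + 1)) = (expR (- (2 * pi * (Y + 1))))%:C.
  rewrite /q /qpow (_ : (_ * _) = (- (2 * pi * (Y + 1)))%:C).
    by rewrite /expC /= cos0 sin0 mulr1.
  by apply/eqP; rewrite eq_complex /=; apply/andP; split; apply/eqP; ring.
move: ul; rewrite qE => ul; apply: (product_exp_bound _ l0 ul).
rewrite expR_gt0 expR_lt1 oppr_lt0 !mulr_gt0 ?pi_gt0//; lra.
Qed.

Local Opaque q qpow expC.

Lemma prod_exprz (K : fieldType) (I : Type) (s : seq I) (F : I -> K) (e : int) :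
  \prod_(i <- s) F i ^ e = (\prod_(i <- s) F i) ^ e.
Proof. by rewrite (big_morph (fun x : K => x ^ e) (fun x y => expfzMl x y e) (exp1rz _ e)). Qed.

Lemma prod_const_iota (K : pzSemiRingType) (x : K) (d : nat) : \prod_(0 <= i < d) x = x ^+ d.
Proof. by rewrite prodr_const_nat subn0. Qed.

(** At the point (a tau + b) / d, q^m is the root of unity e(m b / d) times q^(m a / d), so each [m]
    yields a product over d-th roots of unity. The factors q^h leave a constant and q^(h a). *)
Lemma channel_product (a d M : nat) (h : int) (c : nat -> int) tau : (0 < d)%N ->
  \prod_(0 <= b < d) (q ((a%:R / d%:R : R)%:C * tau + (b%:R / d%:R : R)%:C) ^ h *
     \prod_(1 <= m < M.+1) (1 - q ((a%:R / d%:R : R)%:C * tau + (b%:R / d%:R : R)%:C) ^+ m) ^ c m) =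
  (\prod_(0 <= b < d) qpow h%:~R (b%:R / d%:R : R)%:C) * q tau ^ (h * a%:Z) *
  \prod_(1 <= m < M.+1) (1 - q tau ^+ channel_pow a d m) ^ ((gcdn m d)%:Z * c m).
Proof.
move=> d0; have dR : d%:R != 0 :> R by rewrite pnatr_eq0 -lt0n.
rewrite big_split /=; congr (_ * _).
  under eq_bigr do rewrite qZ qpow_affine mulrC.
  rewrite big_split /=; congr (_ * _).
  transitivity (qpow (h%:~R * (a%:R / d%:R)) tau ^+ d); first exact: prod_const_iota.
  rewrite qpowX qZ.
  by have -> : d%:R * (h%:~R * (a%:R / d%:R)) = (h * a%:Z)%:~R :> R by rewrite intrM -pmulrn; field.
rewrite exchange_big /=; apply: eq_bigr => m _; rewrite prod_exprz.
rewrite -exprz_exp -exprnP; congr (_ ^ _).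
have -> : q tau ^+ channel_pow a d m = qpow (m%:R * (a%:R / d%:R)) tau ^+ (d %/ gcdn m d).
  suff E : (channel_pow a d m)%:R = (d %/ gcdn m d)%:R * (m%:R * (a%:R / d%:R)) :> R.
    by rewrite qX E -qpowX.
  rewrite /channel_pow natrM.
  have g0 : (gcdn m d)%:R != 0 :> R by rewrite pnatr_eq0 -lt0n gcdn_gt0 d0 orbT.
  have e1 : m%:R = (m %/ gcdn m d)%:R * (gcdn m d)%:R :> R by rewrite -natrM divnK ?dvdn_gcdl.
  have e2 : d%:R = (d %/ gcdn m d)%:R * (gcdn m d)%:R :> R by rewrite -natrM divnK ?dvdn_gcdr.
  rewrite [in m%:R * _]e1 [in a%:R / _]e2; move: dR; rewrite {1}e2 mulf_eq0 negb_or => /andP[dg _].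
  by field; rewrite g0.
rewrite -(prod_root_of_unity _ _ (unity_root_prim R d0)).
apply: eq_bigr => b _; congr (1 - _).
rewrite qX qpow_affine mulrC unity_rootX; congr (_ * _).
by rewrite -[in LHS](mul1r m%:R) qpowRM; congr (qpow _ _%:C); rewrite natrM mulrA.
Qed.

Definition hecke_exps (n : nat) (s : seq nat) (c : nat -> int) (m : nat) : int :=
  \sum_(d <- s) channel_exp (n %/ d) d c m.

Lemma hecke_prod_expansion f (h : int) (c : nat -> int) (rho : R) (n : nat) (s : seq nat) :
  (0 < n)%N -> (forall d, d \in s -> (d %| n)%N) -> 0 < rho <= 1 -> exp_bound rho c ->
  has_product_expansion f h c ->
  exists2 ka : R[i], ka != 0 &
    has_product_expansion
      (fun tau => ka * hecke_prod f n [seq (d, b) | d <- s, b <- iota 0 d] tau)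
      (\sum_(d <- s) h * (n %/ d)%N%:Z) (hecke_exps n s c).
Proof.
move=> n0 sn rho01 bc H.
(* The roots of unity left by q^h; dividing by them makes the leading coefficient 1. *)
pose ka (d : nat) : R[i] := \prod_(0 <= b < d) qpow h%:~R (b%:R / d%:R : R)%:C.
have ka0 d : ka d != 0.
  by rewrite prodf_seq_neq0; apply/allP => b _ /=; exact: qpow_neq0.
exists (\prod_(d <- s) (ka d)^-1).
  by rewrite prodf_seq_neq0; apply/allP => d _ /=; rewrite invr_eq0.
have loc d : d \in s -> near_ioo (fun tau =>
    tends_to (fun M => q tau ^ (h * (n %/ d)%N%:Z) *
       \prod_(1 <= m < M.+1) (1 - q tau ^+ m) ^ channel_exp (n %/ d) d c m)
     ((ka d)^-1 * \prod_(0 <= b < d) f (hecke_point n (d, b) tau))).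
  move=> ds; have dn := sn d ds; have d0 : (0 < d)%N by exact: dvdn_gt0 dn.
  have a0 : (0 < n %/ d)%N by rewrite divn_gt0// dvdn_leq.
  have adR : 0 < (n %/ d)%:R / d%:R :> R by rewrite divr_gt0 ?ltr0n.
  have HH := near_ioo_all (s := index_iota 0 d) (P := fun b tau =>
     tends_to (fun M => q (hecke_point n (d, b) tau) ^ h *
       \prod_(1 <= m < M.+1) (1 - q (hecke_point n (d, b) tau) ^+ m) ^ c m)
      (f (hecke_point n (d, b) tau))) (fun b _ => near_ioo_affine (b%:R / d%:R) adR H).
  have rd : 0 < rho ^+ d / 4 by rewrite divr_gt0// exprn_gt0//; case/andP: rho01.
  apply: near_iooW (near_ioo_and HH (near_q_small rd)) => tau [Hb qs].
  have T : tends_to (fun M => ka d * q tau ^ (h * (n %/ d)%N%:Z) *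
        \prod_(1 <= m < M.+1) (1 - q tau ^+ channel_pow (n %/ d) d m) ^ ((gcdn m d)%:Z * c m))
      (\prod_(0 <= b < d) f (hecke_point n (d, b) tau)).
    have T0 := tends_to_prod Hb; set F := (fun M => _) in T0.
    have FE M : F M = _ := channel_product (n %/ d) M h c tau d0.
    by rewrite -(funext FE).
  have qh := q_neq0 tau.
  have T2 := @tends_toMl _ (ka d * q tau ^ (h * (n %/ d)%N%:Z))^-1 _ _ T.
  have kq : ka d * q tau ^ (h * (n %/ d)%N%:Z) != 0 by rewrite mulf_neq0// expfz_neq0.
  have T3 : tends_to (fun M => \prod_(1 <= m < M.+1)
       (1 - q tau ^+ channel_pow (n %/ d) d m) ^ ((gcdn m d)%:Z * c m))
     ((ka d * q tau ^ (h * (n %/ d)%N%:Z))^-1 * \prod_(0 <= b < d) f (hecke_point n (d, b) tau)).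
    by apply: (tends_to_eq _ T2) => M; rewrite mulKf.
  have T4 := channel_rearrange a0 d0 rho01 bc (ltW qs) T3.
  have T5 := @tends_toMl _ (q tau ^ (h * (n %/ d)%N%:Z)) _ _ T4.
  by move: T5; rewrite invfM mulrA [q tau ^ _ * _]mulrCA divff ?mulr1// expfz_neq0.
have q1 : 0 < 1 :> R by [].
apply: near_iooW (near_ioo_and (near_ioo_all loc) (near_q_small q1)) => tau [Hd qs].
have := tends_to_prod Hd; rewrite /hecke_prod big_allpairs_dep -big_split /=.
under [in X in X -> _]eq_bigr do rewrite -iota_index.
apply: tends_to_eq => M; rewrite big_split /=; congr (_ * _).
  by rewrite exprz_sum ?q_neq0.
rewrite exchange_big /= !big_nat; apply: eq_bigr => m /andP[m0 _].
by rewrite /hecke_exps exprz_sum// one_subX_neq0.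
Qed.

Lemma hecke_expansion (N p r : nat) (k h : int) f (a : nat -> R[i]) (c : nat -> int) :
  prime p -> a 0%N = 1 -> has_q_expansion f h a -> has_product_expansion f h c ->
  let H := \sum_(d <- hecke_dens N p r) h * (p ^ r %/ d)%N%:Z in
  let C := hecke_exps (p ^ r) (hecke_dens N p r) c in
  exists K : R[i], [/\ K != 0,
    hecke N p r k f = (fun tau => K * hecke_prod f (p ^ r) (hecke_reps N p r) tau),
    has_product_expansion (hecke N p r k f) H C &
    exists2 b : nat -> int, b 0%N = 1 & has_q_expansion (hecke N p r k f) H (fun n => (b n)%:~R)].
Proof.
move=> pp a0 qf prodf H C.
have n0 : (0 < p ^ r)%N by rewrite expn_gt0 prime_gt0.
have f0 := q_expansion_neq0 a0 qf.
have [rho rho01 bc] := product_expansion_bound f0 prodf.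
have [ka ka0 PE] := hecke_prod_expansion n0 (@hecke_dens_dvd N p r pp) rho01 bc prodf.
have [C0 C00 hE] := heckeE N r k f pp.
pose E tau := ka * hecke_prod f (p ^ r) (hecke_reps N p r) tau.
have E0 : near_ioo (fun tau => E tau != 0).
  have : near_ioo (fun tau => forall x, x \in hecke_reps N p r -> f (hecke_point (p ^ r) x tau) != 0).
    apply: near_ioo_all => x xr; have [xn xb] := hecke_reps_dvd pp xr.
    have x0 := dvdn_gt0 n0 xn.
    by apply: near_ioo_affine f0; rewrite divr_gt0 ?ltr0n// divn_gt0// dvdn_leq.
  apply: near_iooW => tau Hx; rewrite mulf_neq0// /hecke_prod big_seq_cond prodf_seq_neq0.
  by apply/allP => x _; apply/implyP => /andP[xr _]; exact: Hx.
(* The growth argument again, now for the image: its partial products have a nonzero limit near i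
   oo, so its exponents are exponentially bounded too, as the passage to an integral power series
   requires. *)
have [rho' rho'01 bC] := product_expansion_bound E0 PE.
have r40 : 0 < rho' / 4 by rewrite divr_gt0//; case/andP: rho'01.
have QE : has_q_expansion E H (fun n => (prod_coef C n)%:~R).
  apply: near_iooW (near_ioo_and PE (near_q_small r40)) => tau [T qs].
  apply/q_expansion_series; apply: (product_to_series rho'01 bC (ltW qs)).
  have T2 := @tends_toMl _ (q tau ^ (- H)) _ _ T.
  apply: (tends_to_eq _ T2) => M.
  by rewrite mulrA -expfzDr ?q_neq0// addNr expr0z mul1r.
have b0 : (prod_coef C 0)%:~R = 1 :> R[i] by rewrite prod_coef0.
have EE : hecke N p r k f = E.
  have E2 : (fun tau => (ka / C0) * (C0 * hecke_prod f (p ^ r) (hecke_reps N p r) tau)) = E.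
    by apply/funext => tau; rewrite mulrA divfK.
  rewrite hE -E2; move: QE; rewrite -E2 => QE2.
  exact: (@normalizeE (fun tau => C0 * hecke_prod f (p ^ r) (hecke_reps N p r) tau) H
    (fun n => (prod_coef C n)%:~R) (ka / C0) b0 QE2).
exists ka; rewrite EE; split=> //.
by exists (prod_coef C) => //; rewrite prod_coef0.
Qed.

End HeckeExpansion.

(** * Meromorphy and the transformation law *)

Section Meromorphic.
Variable K : numFieldType.
Implicit Types (f g : K -> K) (z w al be : K).

Lemma affine_differentiable al be z : differentiable (fun w => al * w + be) z.
Proof.
apply/derivable1_diffP; apply: derivableD; last exact: derivable_cst.
by apply: derivableM; [exact: derivable_cst|exact: derivable_id].
Qed.

Lemma affine_continuous al be z : (fun w => al * w + be) @ z --> (al * z + be).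
Proof. exact: differentiable_continuous (affine_differentiable al be z). Qed.

Lemma near_affine al be z (P : K -> Prop) :
  (\forall w \near al * z + be, P w) -> \forall w \near z, P (al * w + be).
Proof. by move=> H; exact: (@affine_continuous al be z _ H). Qed.

Lemma near_affine_dnbhs al be z (P : K -> Prop) : al != 0 ->
  (\forall w \near (al * z + be)^', P w) -> \forall w \near z^', P (al * w + be).
Proof.
move=> al0 H; have H2 : \forall w \near al * z + be, w != al * z + be -> P w by exact: H.
apply: filterS (near_affine H2) => w Hw wz; apply: Hw.
by apply: contra wz => /eqP /addIr /(mulfI al0) ->.
Qed.

Lemma derivable_affine_comp g al be z : derivable g (al * z + be) 1 ->
  derivable (fun w => g (al * w + be)) z 1.
Proof.
move=> /derivable1_diffP dg; apply/derivable1_diffP.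
by apply: (@differentiable_comp _ _ _ _ (fun w => al * w + be) g); first exact: affine_differentiable.
Qed.

Lemma meromorphic_affine f al be z : al != 0 -> meromorphic_at f (al * z + be) ->
  meromorphic_at (fun w => f (al * w + be)) z.
Proof.
(* The pole factor scales by al^m, as (al w + be) - (al z + be) = al (w - z). *)
move=> al0 [m [g [dg fg]]]; exists m, (fun w => g (al * w + be) * (al ^+ m)^-1); split.
  apply: filterS (near_affine dg) => w dgw; apply: derivableM; last exact: derivable_cst.
  exact: derivable_affine_comp.
apply: filterS (near_affine_dnbhs al0 fg) => w ->.
by rewrite opprD addrACA subrr addr0 -mulrBr exprMn invfM mulrA.
Qed.

Lemma meromorphicM f g z : meromorphic_at f z -> meromorphic_at g z ->
  meromorphic_at (fun w => f w * g w) z.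
Proof.
move=> [m [f1 [df1 E1]]] [k [g1 [dg1 E2]]]; exists (m + k)%N, (fun w => f1 w * g1 w); split.
  by apply: filterS2 df1 dg1 => w d1 d2; exact: derivableM.
by apply: filterS2 E1 E2 => w -> ->; rewrite exprD invfM mulrACA.
Qed.

Lemma meromorphic_cst (c : K) z : meromorphic_at (fun=> c) z.
Proof.
exists 0%N, (fun=> c); split; first by apply: (@filterE _ (nbhs z)) => w; exact: derivable_cst.
by apply: (@filterE _ (dnbhs z)) => w; rewrite expr0 divr1.
Qed.

Lemma meromorphic_prod (I : eqType) (s : seq I) (F : I -> K -> K) z :
  (forall i, i \in s -> meromorphic_at (F i) z) ->
  meromorphic_at (fun w => \prod_(i <- s) F i w) z.
Proof.
elim: s => [|i s IH] H.
  by under eq_fun do rewrite big_nil; exact: meromorphic_cst.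
under eq_fun do rewrite big_cons; apply: meromorphicM; first by apply: H; rewrite mem_head.
by apply: IH => j js; apply: H; rewrite inE js orbT.
Qed.

Lemma near_all (I : eqType) (s : seq I) (F : set_system K) (FF : Filter F) (P : I -> K -> Prop) :
  (forall i, i \in s -> \forall w \near F, P i w) ->
  \forall w \near F, forall i, i \in s -> P i w.
Proof.
elim: s => [|i s IH] H; first by apply: nearW => w i; rewrite in_nil.
have Hs : \forall w \near F, forall j, j \in s -> P j w.
  by apply: IH => j js; apply: H; rewrite inE js orbT.
apply: filterS2 (H i (mem_head _ _)) Hs => w Pi Ps j.
by rewrite inE => /orP[/eqP -> //|]; exact: Ps.
Qed.

End Meromorphic.

Section Transformation.
Variable R : realType.
Implicit Types (f : R[i] -> R[i]) (tau z : R[i]) (g : 'M[int]_2).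

Lemma near_upper (z : (R[i] : numFieldType)) : 0 < complex.Im z -> \forall w \near z, 0 < complex.Im w.
Proof.
move=> z0; have e0 : 0 < (complex.Im z)%:C by rewrite ltcR.
apply/nbhs_ballP; exists (complex.Im z)%:C => //= w.
rewrite -ball_normE /= nrmE ltcR => H.
have : `|complex.Im (z - w)| <= nrm (z - w).
  rewrite /nrm; case: (z - w) => a b /=.
  by rewrite -sqrtr_sqr ler_wsqrtr// lerDr sqr_ge0.
have -> : complex.Im (z - w) = complex.Im z - complex.Im w by case: z {z0 e0 H} => a b; case: w.
by move=> H2; have := le_lt_trans H2 H; rewrite ltr_norml => /andP[_]; lra.
Qed.

Lemma toR_entry g i j : (toR R g i j)%:C = (g i j)%:~R.
Proof. by rewrite mxE rmorph_int. Qed.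

Lemma hecke_pointE n (x : nat * nat) tau :
  hecke_point n x tau = ((n %/ x.1)%:R * tau + x.2%:R) / x.1%:R.
Proof.
by rewrite /hecke_point !rmorphM !fmorphV !rmorph_nat /= mulrDl mulrAC.
Qed.

Lemma Im_hecke_point n x tau :
  complex.Im (hecke_point n x tau) = (n %/ x.1)%:R / x.1%:R * complex.Im tau.
Proof. exact: Im_affine. Qed.

Lemma Im_hecke_point_gt0 n x tau : (0 < n)%N -> (x.1 %| n)%N -> 0 < complex.Im tau ->
  0 < complex.Im (hecke_point n x tau).
Proof.
move=> n0 xn t0; have x0 := dvdn_gt0 n0 xn.
by rewrite Im_hecke_point mulr_gt0// divr_gt0 ?ltr0n// divn_gt0// dvdn_leq.
Qed.

Lemma cocycle_neq0 g tau : \det g = 1 -> 0 < complex.Im tau -> cocycle (toR R g) tau != 0.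
Proof.
move=> dg t0; rewrite /cocycle; apply/eqP => E.
have E1 := congr1 (@complex.Im R) E; have E2 := congr1 (@complex.Re R) E.
move: E1 E2; rewrite !mxE; case: tau t0 {E} => s t /= t0.
rewrite !(mul0r, mulr0, addr0, subr0, add0r) => /eqP.
rewrite mulf_eq0 (gt_eqF t0) orbF intr_eq0 => /eqP g10.
rewrite g10 mul0r add0r => /eqP; rewrite intr_eq0 => /eqP g11.
by move: dg; rewrite det2E g10 g11 !mulr0 subr0.
Qed.

(** The matrix identity read on points and on automorphy factors; those of the triangular matrices
    are the constants [x.1] and [y.1], hence their quotient. *)
Lemma upper_rep_moebius n (x y : nat * nat) g t tau : (0 < n)%N ->
  (x.1 %| n)%N -> (y.1 %| n)%N -> \det g = 1 -> 0 < complex.Im tau ->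
  upper_rep n x *m g = t *m upper_rep n y ->
  cocycle (toR R t) (hecke_point n y tau) = x.1%:R / y.1%:R * cocycle (toR R g) tau /\
  hecke_point n x (moebius (toR R g) tau) = moebius (toR R t) (hecke_point n y tau).
Proof.
move=> n0 xn yn dg t0 E; have x0 := dvdn_gt0 n0 xn; have y0 := dvdn_gt0 n0 yn.
have c0 := cocycle_neq0 dg t0.
have xR : (x.1%:R : R[i]) != 0 by rewrite pnatr_eq0 -lt0n.
have yR : (y.1%:R : R[i]) != 0 by rewrite pnatr_eq0 -lt0n.
have ent i j := congr1 (fun A : 'M[int]_2 => (A i j)%:~R : R[i]) E.
have := ent 0 0; have := ent 0 1; have := ent 1 0; have := ent 1 1.
rewrite !mulmx2E /upper_rep !mx2E !intrD !intrM -!pmulrn !mul0r !mulr0 !add0r !addr0.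
move: c0; rewrite /moebius /cocycle !toR_entry !hecke_pointE.
set A := (n %/ x.1)%:R; set A' := (n %/ y.1)%:R.
move: (g 0 0)%:~R (g 0 1)%:~R (g 1 0)%:~R (g 1 1)%:~R => a b c e.
move: (t 0 0)%:~R (t 0 1)%:~R (t 1 0)%:~R (t 1 1)%:~R => a' b' c' e' c0 E11 E10 E01 E00.
have C : c' * ((A' * tau + y.2%:R) / y.1%:R) + e' = x.1%:R / y.1%:R * (c * tau + e).
  have -> : c' * ((A' * tau + y.2%:R) / y.1%:R) + e' =
     ((c' * A') * tau + (c' * y.2%:R + e' * y.1%:R)) / y.1%:R by field.
  by rewrite -E10 -E11; field.
split=> //; rewrite C.
have -> : a' * ((A' * tau + y.2%:R) / y.1%:R) + b' =
     ((a' * A') * tau + (a' * y.2%:R + b' * y.1%:R)) / y.1%:R by field.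
by rewrite -E00 -E01; field; rewrite c0 xR yR.
Qed.

Lemma hecke_prod_meromorphic f n (s : seq (nat * nat)) (C : R[i]) : (0 < n)%N ->
  (forall x, x \in s -> (x.1 %| n)%N) -> meromorphic_upper f ->
  meromorphic_upper (fun tau => C * hecke_prod f n s tau).
Proof.
move=> n0 sn mf z z0; apply: meromorphicM; first exact: meromorphic_cst.
apply: meromorphic_prod => x xs; have xn := sn x xs; have x0 := dvdn_gt0 n0 xn.
apply: meromorphic_affine; last exact: mf (Im_hecke_point_gt0 n0 xn z0).
by rewrite -nrm_gt0 nrmR normr_gt0 gt_eqF// divr_gt0 ?ltr0n// divn_gt0// dvdn_leq.
Qed.

(** The new multiplier at [g] is the product of the chi (t g x); the cocycle relation, with the
    factors reordered by the permutation, makes it multiplicative. The quotients of denominators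
    multiply to 1 since [sg g] only reorders them. *)
Lemma hecke_prod_modular (N p r : nat) (k : int) f (C : R[i]) :
  prime p ->
  (exists2 chi, multiplier_system N chi &
     forall g, Gamma0 N g ->
       eq_mero_upper (fun tau => f (moebius (toR R g) tau))
         (fun tau => chi g * cocycle (toR R g) tau ^ k * f tau)) ->
  let s := hecke_reps N p r in
  let F := fun tau => C * hecke_prod f (p ^ r) s tau in
  exists2 chi, multiplier_system N chi &
     forall g, Gamma0 N g ->
       eq_mero_upper (fun tau => F (moebius (toR R g) tau))
         (fun tau => chi g * cocycle (toR R g) tau ^ (k * (size s)%:Z) * F tau).
Proof.
move=> pp [chi [chi1 chiM] Hf] s F.
have n0 : (0 < p ^ r)%N by rewrite expn_gt0 prime_gt0.
have [sg [t [Hst Hperm Hcoc]]] := hecke_permutation N r pp.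
exists (fun g => \prod_(x <- s) chi (t g x)).
  split=> [g Gg|g h Gg Gh].
    rewrite normr_prod big_seq big1// => x xs.
    by apply: chi1; have [] := Hst g x Gg xs.
  rewrite big_seq; under eq_bigr => x xs.
    have [G1 s1 _] := Hst g x Gg xs; have [G2 _ _] := Hst h _ Gh s1.
    rewrite (Hcoc _ _ _ Gg Gh xs) chiM//; over.
  rewrite -big_seq big_split /=; congr (_ * _).
  by rewrite -[RHS](perm_big _ (Hperm g Gg)) big_map.
move=> g Gg z z0; have dg : \det g = 1 := proj1 Gg.
(* The law for [f] holds only on punctured neighbourhoods, which are pulled back along the injective
   affine maps and intersected over the finite list. *)
have H1 : \forall w \near (z : (R[i] : numFieldType))^', forall x, x \in s ->
    f (moebius (toR R (t g x)) (hecke_point (p ^ r) (sg g x) w)) =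
    chi (t g x) * cocycle (toR R (t g x)) (hecke_point (p ^ r) (sg g x) w) ^ k *
      f (hecke_point (p ^ r) (sg g x) w).
  apply: near_all => x xs; have [Gt ys _] := Hst g x Gg xs.
  have [yn yb] := hecke_reps_dvd pp ys; have y0 := dvdn_gt0 n0 yn.
  apply: (@near_affine_dnbhs R[i] ((p ^ r %/ (sg g x).1)%:R / (sg g x).1%:R : R)%:C
    ((sg g x).2%:R / (sg g x).1%:R : R)%:C z (fun w => f (moebius (toR R (t g x)) w) =
    chi (t g x) * cocycle (toR R (t g x)) w ^ k * f w)).
    by rewrite -nrm_gt0 nrmR normr_gt0 gt_eqF// divr_gt0 ?ltr0n// divn_gt0// dvdn_leq.
  exact: (Hf _ Gt _ (Im_hecke_point_gt0 n0 yn z0)).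
have H2 : \forall w \near (z : (R[i] : numFieldType))^', 0 < complex.Im w.
  by apply: filterS (near_upper z0) => w.
apply: filterS2 H1 H2 => w Hw w0.
have c0 := cocycle_neq0 dg w0.
rewrite /F [RHS]mulrCA; congr (_ * _).
rewrite /hecke_prod -/s.
transitivity (\prod_(x <- s) (chi (t g x) * (x.1%:R / (sg g x).1%:R) ^ k * cocycle (toR R g) w ^ k *
    f (hecke_point (p ^ r) (sg g x) w))).
  rewrite big_seq [RHS]big_seq; apply: eq_bigr => x xs.
  have [Gt ys E] := Hst g x Gg xs.
  have [yn _] := hecke_reps_dvd pp ys; have [xn _] := hecke_reps_dvd pp xs.
  have [Ec ->] := upper_rep_moebius n0 xn yn dg w0 E.
  by rewrite (Hw x xs) Ec expfzMl !mulrA.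
rewrite !big_split /=.
have -> : \prod_(x <- s) f (hecke_point (p ^ r) (sg g x) w) = \prod_(x <- s) f (hecke_point (p ^ r) x w).
  by rewrite -[RHS](perm_big _ (Hperm g Gg)) big_map.
congr (_ * _).
have -> : \prod_(x <- s) ((x.1%:R : R[i]) / (sg g x).1%:R) ^ k = 1.
  rewrite prod_exprz big_split /= prodfV.
  have -> : \prod_(x <- s) ((sg g x).1%:R : R[i]) = \prod_(x <- s) x.1%:R.
    by rewrite -[RHS](perm_big _ (Hperm g Gg)) big_map.
  rewrite divff ?exp1rz// big_seq_cond prodf_seq_neq0; apply/allP => x _.
  apply/implyP => /andP[xs _].
  by have [xn _] := hecke_reps_dvd pp xs; rewrite pnatr_eq0 -lt0n (dvdn_gt0 n0).
rewrite mulr1; congr (_ * _).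
by rewrite -exprz_exp -exprnP big_const_seq count_predT -Monoid.iteropE.
Qed.

End Transformation.

(** * Expansions at the cusps *)

Section SeriesOperations.
Variable R : realType.
Implicit Types (X s t : R[i]) (a b : nat -> R[i]) (tau : R[i]).

Definition stretch (A : nat) a (m : nat) : R[i] := if (A %| m)%N then a (m %/ A)%N else 0.

(** [(m + A.-1) %/ A] is the ceiling of m / A, the number of multiples of [A] below [m]; it indexes
    the partial sums of a stretched series. *)
Lemma ceil_divnS A m : (0 < A)%N ->
  ((m.+1 + A.-1) %/ A = (m + A.-1) %/ A + (A %| m))%N /\
  ((A %| m)%N -> (m + A.-1) %/ A = m %/ A)%N.
Proof.
case: A => // A _; rewrite /= addSn -addnS.
have -> : ((m + A.+1) %/ A.+1 = (m %/ A.+1).+1)%N by rewrite divnDr ?dvdnn// divnn addn1.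
have -> : ((m + A) %/ A.+1 = m %/ A.+1 + (m %% A.+1 + A) %/ A.+1)%N.
  by rewrite {1}(divn_eq m A.+1) -addnA divnMDl.
have lt := ltn_pmod m (ltn0Sn A).
rewrite /dvdn; have [->|r0] := eqVneq (m %% A.+1)%N 0%N.
  by rewrite add0n (divn_small (ltnSn A)) addn0 addn1.
have rp : (0 < m %% A.+1)%N by rewrite lt0n.
have -> : (m %% A.+1 + A = 1 * A.+1 + (m %% A.+1).-1)%N by lia.
have h : ((m %% A.+1).-1 %/ A.+1 = 0)%N by rewrite divn_small//; lia.
by rewrite divnMDl// h !addn0 addn1.
Qed.

Lemma series_stretch (A : nat) (u : nat -> R[i]) s : (0 < A)%N ->
  tends_to (series u) s -> tends_to (series (stretch A u)) s.
Proof.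
move=> A0 H.
have E M : series (stretch A u) M = series u ((M + A.-1) %/ A)%N.
  elim: M => [|M IH].
    by rewrite add0n divn_small ?ltn_predL// !seriesE !big_geq.
  rewrite seriesE big_nat_recr//= -seriesE IH; have [-> h] := ceil_divnS M A0.
  rewrite /stretch; case: ifP => AM; last by rewrite addn0 addr0.
  by rewrite addn1 !seriesE big_nat_recr//= h.
have lim : (fun M => (M + A.-1) %/ A)%N @ \oo --> \oo.
  move=> P [N _ NP]; exists (N * A)%N => // M /= NM; apply: NP => /=.
  by rewrite leq_divRL// (leq_trans NM)// leq_addr.
exact: (tends_to_eq (fun M => esym (E M)) (tends_to_subseqP H lim)).
Qed.

Definition cauchy_coef a b (n : nat) : R[i] := \sum_(i < n.+1) a i * b (n - i)%N.

(** Partial sums of the product series are compared with products of truncations. These agree in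
    degrees below [M]; beyond, coefficients are at most (n + 1) B B' rho^-n, and n + 1 <= 2^n
    against 4^-n leaves a geometric tail. *)
Lemma series_cauchy a b X s t (B B' rho : R) : 0 < rho -> 0 <= B -> 0 <= B' ->
  (forall n, nrm (a n) * rho ^+ n <= B) -> (forall n, nrm (b n) * rho ^+ n <= B') ->
  nrm X <= rho / 4 ->
  tends_to (series (fun n => a n * X ^+ n)) s -> tends_to (series (fun n => b n * X ^+ n)) t ->
  tends_to (series (fun n => cauchy_coef a b n * X ^+ n)) (s * t).
Proof.
move=> r0 B0 B'0 Ha Hb X4 Hs Ht.
pose pa M := \poly_(i < M) a i; pose pb M := \poly_(i < M) b i.
have pE c M : (\poly_(i < M) c i).[X] = series (fun n => c n * X ^+ n) M.
  by rewrite horner_poly seriesE big_mkord.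
have coefE M n : (n < M)%N -> (pa M * pb M)`_n = cauchy_coef a b n.
  move=> nM; rewrite coefM; apply: eq_bigr => i _; rewrite !coef_poly.
  have iM : (i < M)%N by apply: leq_ltn_trans nM; rewrite -ltnS.
  by rewrite iM (leq_ltn_trans (leq_subr _ _) nM).
have bound M n : nrm ((pa M * pb M)`_n) * rho ^+ n <= n.+1%:R * (B * B').
  apply: (@le_trans _ _ ((\sum_(i < n.+1) nrm ((pa M)`_i * (pb M)`_(n - i)%N)) * rho ^+ n)).
    by rewrite coefM ler_wpM2r ?exprn_ge0 ?(ltW r0)// nrm_sum.
  rewrite mulr_suml; apply: (@le_trans _ _ (\sum_(i < n.+1) B * B')).
    apply: ler_sum => i _; rewrite nrmM.
    have -> : rho ^+ n = rho ^+ i * rho ^+ (n - i) by rewrite -exprD subnKC// -ltnS.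
    rewrite mulrACA ler_pM ?mulr_ge0 ?nrm_ge0 ?exprn_ge0 ?(ltW r0)//.
      by rewrite coef_poly; case: ifP => // _; rewrite nrm0 mul0r.
    by rewrite coef_poly; case: ifP => // _; rewrite nrm0 mul0r.
  by rewrite sumr_const card_ord mulr_natl.
have diff M : nrm (series (fun n => cauchy_coef a b n * X ^+ n) M -
     (pa M).[X] * (pb M).[X]) <= 2 * (B * B') * 2^-1 ^+ M.
  rewrite -hornerM nrmB (@horner_coef_wide _ (maxn (size (pa M * pb M)) M)) ?leq_maxl//.
  rewrite -(big_mkord xpredT (fun i => (pa M * pb M)`_i * X ^+ i)).
  rewrite (@big_cat_nat _ _ _ M) ?leq_maxr//= seriesE.
  have -> : \sum_(0 <= i < M) (pa M * pb M)`_i * X ^+ i =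
      \sum_(0 <= k < M) cauchy_coef a b k * X ^+ k.
    by rewrite !big_nat; apply: eq_bigr => i /andP[_ iM]; rewrite coefE.
  rewrite addrAC subrr add0r; apply: series_tail_le; first exact: mulr_ge0.
  move=> n _; rewrite nrmM nrmX.
  apply: (@le_trans _ _ (nrm (pa M * pb M)`_n * (rho ^+ n * 4^-1 ^+ n))).
    rewrite ler_wpM2l ?nrm_ge0// -exprMn lerXn2r ?nnegrE ?nrm_ge0//.
    by rewrite mulr_ge0 ?invr_ge0 ?(ltW r0).
  rewrite mulrA; apply: (@le_trans _ _ (n.+1%:R * (B * B') * 4^-1 ^+ n)).
    by rewrite ler_wpM2r ?exprn_ge0 ?invr_ge0.
  rewrite mulrAC mulrC ler_wpM2l ?mulr_ge0//.
  have -> : 4^-1 = 2^-1 * 2^-1 :> R by rewrite -invfM -natrM.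
  rewrite exprMn mulrA ler_piMl ?exprn_ge0 ?invr_ge0//.
  by rewrite exprVn ler_pdivrMr ?exprn_gt0// mul1r -natrX ler_nat ltn_expl.
have prod : tends_to (fun M => (pa M).[X] * (pb M).[X]) (s * t).
  by apply: tends_toM; [apply: (tends_to_eq _ Hs)|apply: (tends_to_eq _ Ht)] => M; rewrite pE.
have zero : tends_to (fun M => series (fun n => cauchy_coef a b n * X ^+ n) M -
     (pa M).[X] * (pb M).[X]) 0.
  apply: (@tends_to_squeeze _ _ _ (fun M => 2 * (B * B') * 2^-1 ^+ M)).
    by apply: nearW => M; rewrite subr0.
  exact: cvg_geom_half.
rewrite -[s * t]add0r; apply: (tends_to_eq _ (tends_toD zero prod)) => M.
by rewrite subrK.
Qed.

End SeriesOperations.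

Section CuspExpansions.
Variable R : realType.
Implicit Types (f g : R[i] -> R[i]) (a b : nat -> R[i]) (tau : R[i]).

(** With the fractional power divided out, the expansion is an ordinary power series in the local
    parameter q^(1/w). *)
Definition cusp_series (w : nat) (ka : R) a f : Prop :=
  near_ioo (fun tau =>
    tends_to (series (fun n => a n * qpow (w%:R^-1) tau ^+ n)) (qpow (- (ka / w%:R)) tau * f tau)).

Lemma cusp_seriesP f : meromorphic_at_ioo f <->
  exists w ka a, (0 < w)%N /\ cusp_series w ka a f.
Proof.
have E w ka a tau : (0 < w)%N ->
   tends_to (series (fun n => a n * qpow ((n%:R + ka) / w%:R) tau)) (f tau) <->
   tends_to (series (fun n => a n * qpow (w%:R^-1) tau ^+ n)) (qpow (- (ka / w%:R)) tau * f tau).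
  move=> w0; have Es s : series (fun n => a n * qpow ((n%:R + ka) / w%:R) tau) s =
    qpow (ka / w%:R) tau * series (fun n => a n * qpow (w%:R^-1) tau ^+ n) s.
    rewrite !seriesE mulr_sumr; apply: eq_bigr => n _.
    by rewrite qpowX [RHS]mulrCA -qpowD -mulrDl [ka + _]addrC.
  have c : qpow (- (ka / w%:R)) tau * qpow (ka / w%:R) tau = 1 by rewrite -qpowD addNr qpow0.
  split=> H.
    apply: (tends_to_eq _ (@tends_toMl _ (qpow (- (ka / w%:R)) tau) _ _ H)) => s.
    by rewrite Es mulrA c mul1r.
  have -> : f tau = qpow (ka / w%:R) tau * (qpow (- (ka / w%:R)) tau * f tau).
    by rewrite mulrA [X in X * _]mulrC c mul1r.
  by apply: (tends_to_eq _ (@tends_toMl _ (qpow (ka / w%:R) tau) _ _ H)) => s; rewrite Es.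
split=> [[w [ka [a [w0 H]]]]|[w [ka [a [w0 H]]]]]; exists w, ka, a;
  (split; first exact: w0).
  by apply: near_iooW H => tau /(E _ _ _ _ w0).
by apply: near_iooW H => tau H; apply/(E _ _ _ _ w0).
Qed.

Lemma cusp_series_refine w v ka a f : (0 < w)%N -> (0 < v)%N -> cusp_series w ka a f ->
  cusp_series (w * v) (ka * v%:R) (stretch v a) f.
Proof.
move=> w0 v0; apply: near_iooW => tau H.
have vR : v%:R != 0 :> R by rewrite pnatr_eq0 -lt0n.
have wR : w%:R != 0 :> R by rewrite pnatr_eq0 -lt0n.
have -> : ka * v%:R / (w * v)%:R = ka / w%:R by rewrite natrM; field; rewrite ?vR ?wR.
apply: (tends_to_eq _ (series_stretch v0 H)) => M.
rewrite !seriesE; apply: eq_bigr => m _; rewrite /stretch; case: ifP => vm; last by rewrite mul0r.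
congr (_ * _); rewrite !qpowX.
suff -> : (m %/ v)%:R * w%:R^-1 = m%:R * (w * v)%:R^-1 :> R by [].
have e : m%:R = (m %/ v)%:R * v%:R :> R by rewrite -natrM divnK.
by rewrite e natrM; field; rewrite ?wR ?vR.
Qed.

(** The translation contributes a phase, put into the coefficients; the scaling by A / d widens the
    cusp by [d] and spreads the exponents over multiples of [A]. *)
Lemma meromorphic_at_ioo_affine f (A d : nat) (be : R) : (0 < A)%N -> (0 < d)%N ->
  meromorphic_at_ioo f ->
  meromorphic_at_ioo (fun tau => f ((A%:R / d%:R : R)%:C * tau + be%:C)).
Proof.
move=> A0 d0 [w [ka [a [w0 H]]]].
have AR : A%:R != 0 :> R by rewrite pnatr_eq0 -lt0n.
have dR : d%:R != 0 :> R by rewrite pnatr_eq0 -lt0n.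
have wR : w%:R != 0 :> R by rewrite pnatr_eq0 -lt0n.
have adR : 0 < A%:R / d%:R :> R by rewrite divr_gt0 ?ltr0n.
exists (w * d)%N, (ka * A%:R), (stretch A (fun n => a n * qpow ((n%:R + ka) / w%:R) be%:C)).
split; first by rewrite muln_gt0 w0.
apply: near_iooW (near_ioo_affine be adR H) => tau Ht.
apply: (tends_to_eq _ (series_stretch A0 Ht)) => M.
rewrite !seriesE; apply: eq_bigr => m _; rewrite /stretch; case: ifP => Am; last by rewrite mul0r.
suff E : ((m %/ A)%:R + ka) / w%:R * (A%:R / d%:R) = (m%:R + ka * A%:R) / (w * d)%:R :> R.
  by rewrite qpow_affine E mulrA mulrAC.
have e : m%:R = (m %/ A)%:R * A%:R :> R by rewrite -natrM divnK.
by rewrite e natrM; field; rewrite ?wR ?dR.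
Qed.

(** Both expansions are refined to the common width w v, where the shifts [ka] and [la] add and the
    coefficients convolve. *)
Lemma meromorphic_at_iooM f g : meromorphic_at_ioo f -> meromorphic_at_ioo g ->
  meromorphic_at_ioo (fun tau => f tau * g tau).
Proof.
move=> /cusp_seriesP[w [ka [a [w0 Ha]]]] /cusp_seriesP[v [la [b [v0 Hb]]]].
have {}Ha := cusp_series_refine w0 v0 Ha.
have {}Hb := cusp_series_refine v0 w0 Hb.
apply/cusp_seriesP; exists (w * v)%N, (ka * v%:R + la * w%:R),
  (cauchy_coef (stretch v a) (stretch w b)).
have wv0 : (0 < w * v)%N by rewrite muln_gt0 w0.
split; first exact: wv0.
rewrite mulnC in Hb.
move: (ka * v%:R) (la * w%:R) (stretch v a) (stretch w b) (w * v)%N wv0 Ha Hb.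
move=> {w0 v0 ka la a b w v} ka la a b w w0 Ha Hb.
have [Y HY] := near_ioo_and Ha Hb.
have [t0 Yt0] := exists_Im_gt Y; have [Ha0 Hb0] := HY t0 Yt0.
have [B B0 Ba] := series_bound Ha0; have [B' B'0 Bb] := series_bound Hb0.
have r0 : 0 < nrm (qpow w%:R^-1 t0) by rewrite nrm_gt0 qpow_neq0.
have wR : 0 < w%:R^-1 :> R by rewrite invr_gt0 ltr0n.
have r4 : 0 < nrm (qpow w%:R^-1 t0) / 4 by rewrite divr_gt0.
apply: near_iooW (near_ioo_and (near_ioo_and Ha Hb) (near_ioo_small wR r4)) => tau [[h1 h2] h3].
rewrite mulrDl opprD qpowD mulrACA.
exact: (series_cauchy r0 (ltW B0) (ltW B'0) Ba Bb (ltW h3) h1 h2).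
Qed.

Lemma meromorphic_at_ioo_cst (c : R[i]) : meromorphic_at_ioo (fun=> c).
Proof.
exists 1%N, 0, (fun n => if n == 0%N then c else 0); split; first by [].
exists 0 => tau _.
apply/tends_to_shift; rewrite (_ : (fun n => _) = fun=> c); first exact: tends_to_cst.
apply/funext => M.
rewrite seriesE big_nat_recl//= add0r mul0r qpow0 mulr1 big1 ?addr0// => i _.
by rewrite mul0r.
Qed.

Lemma meromorphic_at_ioo_eq f g : near_ioo (fun tau => f tau = g tau) ->
  meromorphic_at_ioo f -> meromorphic_at_ioo g.
Proof.
move=> fg [w [ka [a [w0 H]]]]; exists w, ka, a; split; first exact: w0.
by apply: near_iooW (near_ioo_and fg H) => tau [->].
Qed.

Lemma meromorphic_at_ioo_prod (I : eqType) (s : seq I) (F : I -> R[i] -> R[i]) :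
  (forall i, i \in s -> meromorphic_at_ioo (F i)) ->
  meromorphic_at_ioo (fun tau => \prod_(i <- s) F i tau).
Proof.
elim: s => [|i s IH] H.
  by under eq_fun do rewrite big_nil; exact: meromorphic_at_ioo_cst.
under eq_fun do rewrite big_cons; apply: meromorphic_at_iooM; first by apply: H; rewrite mem_head.
by apply: IH => j js; apply: H; rewrite inE js orbT.
Qed.

Lemma slash_SL2 (k : int) (g : 'M[int]_2) f tau : \det g = 1 ->
  slash k (toR R g) f tau = cocycle (toR R g) tau ^ (- k) * f (moebius (toR R g) tau).
Proof.
by move=> dg; rewrite /slash /toR det_map_mx dg rmorph1 powR1 mul1r.
Qed.

Lemma exprz_cancel (K : fieldType) (x y z : K) (k : int) : x != 0 ->
  x ^ k * ((x * y) ^ (- k) * z) = y ^ (- k) * z.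
Proof.
by move=> x0; rewrite expfzMl mulrA [x ^ k * _]mulrA -expfzDr// subrr expr0z mul1r.
Qed.

(** The Hermite form carries [g] across each triangular matrix, so each factor becomes an expansion
    of [f] at some cusp composed with an affine map. The remaining quotients of denominators form a
    constant. *)
Lemma hecke_prod_cusps (n : nat) (k : int) (s : seq (nat * nat)) f (C : R[i]) : (0 < n)%N ->
  (forall x, x \in s -> (x.1 %| n)%N) ->
  (forall g : 'M[int]_2, SL2Z g -> meromorphic_at_ioo (slash k (toR R g) f)) ->
  forall g : 'M[int]_2, SL2Z g -> meromorphic_at_ioo
    (slash (k * (size s)%:Z) (toR R g) (fun tau => C * hecke_prod f n s tau)).
Proof.
move=> n0 sn H g dg; have {}dg : \det g = 1 := dg.
have /choice[F HF] : forall x : nat * nat, exists ty : 'M[int]_2 * (nat * nat), x \in s ->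
   [/\ \det ty.1 = 1, (ty.2.1 %| n)%N & upper_rep n x *m g = ty.1 *m upper_rep n ty.2].
  move=> x; have [xs|xs] := boolP (x \in s); last by exists (g, x).
  have dM : \det (upper_rep n x *m g) = n%:Z by rewrite det_mulmx det_upper_rep ?sn// dg mulr1.
  by have [t [y [dt yn yb E]]] := hermite_form n0 dM; exists (t, y).
pose t x := (F x).1; pose y x := (F x).2.
have Q : meromorphic_at_ioo (fun tau => (C * \prod_(x <- s) ((x.1%:R : R[i]) / (y x).1%:R) ^ k) *
    \prod_(x <- s) slash k (toR R (t x)) f (hecke_point n (y x) tau)).
  apply: meromorphic_at_iooM; first exact: meromorphic_at_ioo_cst.
  apply: meromorphic_at_ioo_prod => x xs; have [dt yn _] := HF x xs.
  have y0 := dvdn_gt0 n0 yn.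
  apply: (@meromorphic_at_ioo_affine _ (n %/ (y x).1) (y x).1) => //.
    by rewrite divn_gt0// dvdn_leq.
  exact: H.
apply: meromorphic_at_ioo_eq Q; exists 0 => tau t0.
have c0 := cocycle_neq0 dg t0.
rewrite slash_SL2// [RHS]mulrCA -mulrA; congr (_ * _).
rewrite -big_split /=.
have -> : cocycle (toR R g) tau ^ (- (k * (size s)%:Z)) = \prod_(x <- s) cocycle (toR R g) tau ^ (- k).
  by rewrite -mulNr -exprz_exp -exprnP big_const_seq count_predT -Monoid.iteropE.
rewrite /hecke_prod -big_split big_seq [RHS]big_seq; apply: eq_bigr => x xs /=.
have [dt yn E] := HF x xs; have [xn] := sn x xs.
have x0 := dvdn_gt0 n0 xn; have y0 := dvdn_gt0 n0 yn.
have [Ec ->] := upper_rep_moebius n0 xn yn dg t0 E.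
rewrite slash_SL2// -/(t x) -/(y x) in Ec *; rewrite Ec.
have xyR : (x.1%:R : R[i]) / (y x).1%:R != 0.
  by rewrite mulf_neq0// ?invr_eq0 pnatr_eq0 -lt0n.
exact: exprz_cancel.
Qed.

End CuspExpansions.

(** * Weight, order at infinity, and conclusion *)

Section HeckeSums.
Variables (N p r : nat).
Hypothesis pp : prime p.

Lemma size_hecke_reps : size (hecke_reps N p r) = \sum_(d <- hecke_dens N p r) d.
Proof.
rewrite /hecke_reps size_allpairs_dep sumnE big_map; apply: eq_bigr => d _.
by rewrite size_iota.
Qed.

Lemma sum_codivisors : (\sum_(d <- divisors (p ^ r)) p ^ r %/ d)%N = sigma (p ^ r).
Proof.
rewrite /sigma !(perm_big _ (perm_divisors_primepow pp r)) !big_map iota_index.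
rewrite [RHS]big_nat_rev /= !big_nat; apply: eq_bigr => i /andP[_ ir].
by rewrite add0n subSS expnB ?prime_gt0// -ltnS.
Qed.

Lemma hecke_order (h : int) : \sum_(d <- hecke_dens N p r) h * (p ^ r %/ d)%N%:Z =
  if (p %| N)%N then h else h * (sigma (p ^ r))%:Z.
Proof.
rewrite -mulr_sumr /hecke_dens; case: ifP => _.
  by rewrite big_seq1 divnn expn_gt0 prime_gt0//= mulr1.
by rewrite -sum_codivisors (big_morph Posz PoszD (erefl _)).
Qed.

End HeckeSums.

(** The product starts at index 1, and the closed exponent formulas are matched with the collected
    exponents only at positive indices. *)
Lemma product_expansion_eq (R : realType) (f : R[i] -> R[i]) (h : int) (c c' : nat -> int) :
  (forall m, (0 < m)%N -> c m = c' m) -> has_product_expansion f h c ->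
  has_product_expansion f h c'.
Proof.
move=> cc; apply: near_iooW => tau; apply: tends_to_eq => M; congr (_ * _).
by rewrite !big_nat; apply: eq_bigr => m /andP[m0 _]; rewrite cc.
Qed.

Lemma hecke_in_M (R : realType) (N p r : nat) (k h : int) (f : R[i] -> R[i]) (c : nat -> int) :
  prime p -> in_M N k h f -> has_product_expansion f h c ->
  let H := \sum_(d <- hecke_dens N p r) h * (p ^ r %/ d)%N%:Z in
  in_M N (k * (size (hecke_reps N p r))%:Z) H (hecke N p r k f) /\
  has_product_expansion (hecke N p r k f) H (hecke_exps (p ^ r) (hecke_dens N p r) c).
Proof.
move=> pp [[mf tf cf] [a a0 qf]] hc H.
have n0 : (0 < p ^ r)%N by rewrite expn_gt0 prime_gt0.
have a0' : (a 0%N)%:~R = 1 :> R[i] by rewrite a0.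
have [K [K0 hE hP hQ]] := hecke_expansion N r k pp a0' qf hc.
have sn x : x \in hecke_reps N p r -> (x.1 %| p ^ r)%N by move=> /(hecke_reps_dvd pp)[].
split; last exact: hP.
split; last exact: hQ.
rewrite hE; split.
- exact: hecke_prod_meromorphic n0 sn mf.
- exact: hecke_prod_modular pp tf.
- exact: hecke_prod_cusps n0 sn cf.
Qed.

Theorem theorem1p2 (R : realType) (N p r : nat) (k h : int)
    (f : R[i] -> R[i]) (c : nat -> int)
    (hN : (1 <= N)%N) (hp : prime p) (hr : (1 <= r)%N)
    (hf : in_M N k h f) (hc : has_product_expansion f h c) :
  ((~~ (p %| N)%N ->
      in_M N (k * (sigma (p ^ r))%:Z) (h * (sigma (p ^ r))%:Z)
        (hecke N p r k f)) /\
   ((p %| N)%N ->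
      in_M N (k * (p ^ r)%:Z) h (hecke N p r k f))) /\
  ((~~ (p %| N)%N ->
      has_product_expansion (hecke N p r k f) (h * (sigma (p ^ r))%:Z)
        (hecke_exp_ndvd p r c)) /\
   ((p %| N)%N ->
      has_product_expansion (hecke N p r k f) h (hecke_exp_dvd p r c))).
Proof.
have [HM HP] := hecke_in_M r hp hf hc.
(* The weight is multiplied by the number of representatives, which is the sum of the denominators
   [d]; the order at infinity is multiplied by the sum of the p^r / d. *)
move: HM HP; rewrite (hecke_order N r hp) size_hecke_reps /hecke_exps /hecke_dens.
case: (boolP (p %| N)%N) => pN.
  rewrite big_seq1 => HM HP.
  split; split; [by move=> /negP[]|move=> _; exact: HM|by move=> /negP[]|move=> _].
  apply: product_expansion_eq HP => m m0.
  by rewrite big_seq1 hecke_exp_dvdE.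
rewrite -/(sigma (p ^ r)) => HM HP.
split; split; [move=> _; exact: HM|discriminate|move=> _|discriminate].
by apply: product_expansion_eq HP => m m0; rewrite hecke_exp_ndvdE.
Qed.
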